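(* There exists a probability measure $\sigma$ on $\mathbb{T}$ with infinite support belonging to the Szeg\H{o} class such that the limit $\lim_{n\to\infty}\phi_n^*(z,\sigma)$ does not exist for any $z\in\mathbb{T}$.
   Context: $\mathbb{T}$ is the unit circle and $m$ the normalized Lebesgue (probability) measure on $\mathbb{T}$. For a probability measure $\sigma$ on $\mathbb{T}$ with infinite support, $\phi_n(z,\sigma)$ denotes the orthonormal polynomials: $\deg\phi_n=n$, the leading coefficient of $\phi_n$ is positive, $\int_{\mathbb{T}}\phi_n\overline{\phi_k}\,d\sigma=\delta_{nk}$. For a polynomial $Q$ of degree $n$, $Q^*(z):=z^n\overline{Q(\bar z^{-1})}$. The measure $\sigma$ is in the Szeg\H{o} class if, writing $d\sigma=w\,dm+d\sigma_s$ with $\sigma_s$ singular, $\int_{\mathbb{T}}\log w\,dm>-\infty$. *)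

(* Defs.v *)
From HB Require Import structures.
From mathcomp Require Import all_boot all_order all_algebra.
From mathcomp Require Import all_classical all_reals all_analysis.
From mathcomp.real_closed Require Import complex.

Set Implicit Arguments.
Unset Strict Implicit.
Unset Printing Implicit Defensive.

Import Order.TTheory GRing.Theory Num.Theory.
Local Open Scope classical_set_scope.
Local Open Scope ring_scope.

(* The unit circle T is parametrized by the angle x in [0,1) via
   x |-> e(x) = exp(2 pi i x) = cos(2 pi x) + i sin(2 pi x).
   Under this parametrization the normalized Lebesgue measure m on T is the
   Lebesgue measure on [0,1), and a (Borel) probability measure on T is a
   Borel measure on R of total mass 1 carried by [0,1). *)

Section Defs.
Variable R : realType.

Definition cnorm (z : R[i]) : R := ComplexField.Normc.normc z.

Definition I01 : set R := `[0%R, 1%R[.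

Definition eT (x : R) : R[i] :=
  Complex (cos (2 * pi * x)) (sin (2 * pi * x)).

Definition prob_on_T (sigma : {measure set R -> \bar R}) : Prop :=
  sigma I01 = 1%E /\ sigma (~` I01) = 0%E.

Definition supp (sigma : {measure set R -> \bar R}) : set R[i] :=
  [set z | cnorm z = 1 /\
    forall e : R, 0 < e -> (0 < sigma (I01 `&` [set x | (cnorm (eT x - z) < e)%R]))%E].

Definition infinite_support (sigma : {measure set R -> \bar R}) : Prop :=
  ~ finite_set (supp sigma).

Definition cint (sigma : {measure set R -> \bar R}) (f : R -> R[i]) : R[i] :=
  Complex (Rintegral sigma I01 (fun x => complex.Re (f x)))
          (Rintegral sigma I01 (fun x => complex.Im (f x))).

Definition is_OPUC (sigma : {measure set R -> \bar R}) (phi : nat -> {poly R[i]})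
  : Prop :=
  (forall n, size (phi n) = n.+1 /\ 0 < lead_coef (phi n)) /\
  (forall n k, cint sigma (fun x => (phi n).[eT x] * conjc ((phi k).[eT x]))
               = (n == k)%:R).

Definition Qstar (n : nat) (Q : {poly R[i]}) (z : R[i]) : R[i] :=
  z ^+ n * conjc (Q.[(conjc z)^-1]).

(* Szego class: d sigma = w dm + d sigma_s with sigma_s singular (w.r.t. m)
   and int log w dm > -oo  (log 0 = -oo, via lne) *)
Definition szego_class (sigma : {measure set R -> \bar R}) : Prop :=
  exists (w : R -> R) (sigma_s : {measure set R -> \bar R}),
    [/\ measurable_fun I01 w,
        (forall x, 0 <= w x),
        (exists N : set R, [/\ measurable N, N `<=` I01,
             (@lebesgue_measure R) N = 0%E & sigma_s (I01 `\` N) = 0%E]),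
        (forall A : set R, measurable A -> A `<=` I01 ->
             sigma A = (\int[@lebesgue_measure R]_(x in A) (w x)%:E + sigma_s A)%E)
      & (-oo < \int[@lebesgue_measure R]_(x in I01) lne (w x)%:E)%E].

Definition cseq_converges (a : nat -> R[i]) : Prop :=
  exists l : R[i], forall e : R, 0 < e ->
    exists N : nat, forall n : nat, (N <= n)%N -> cnorm (a n - l) < e.

End Defs.

(* Main.v *)
Require Import Defs.
From HB Require Import structures.
From mathcomp Require Import all_boot all_order all_algebra.
From mathcomp Require Import all_classical all_reals all_analysis.
From mathcomp.real_closed Require Import complex.
From mathcomp Require Import measurable_realfun ring lra zify.

(* A sequence [al] of Verblunsky coefficients determines the monic polynomials
   [Phi_n] by the Szego recursion; on the circle [v_n = Phi_n^*(z)] satisfies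
   [v_(n+1) = v_n - al_n z^(n+1) conj v_n].  We choose [al] such that the moduli
   [|v_n|] converge uniformly along a subsequence while the arguments of [v_n]
   oscillate at every point of the circle.

   If the increments [a_n = - al_n z^(n+1)] have small partial sums [A_n], then
   summation by parts shows that [v] is essentially rotated by the area
   [sum Im (conj a_n A_n)] enclosed by the path [A].  A block of coefficients of
   size [e], of length [K] and of frequency [k / K], moves [A] along a circle of
   radius about [e / t] at distance [t] from the resonance, hence rotates [v] by
   about [K e^2 / t]; a triangular profile brings [A] back close to [0].  A stage
   runs through all frequencies [k / K] with [e = la / K].  The rotations met
   before the resonance at [z] add up to [la^2 log K], which is large when
   [K] is, whereas Parseval's identity over the [K]-th roots of unity bounds the
   sum of all other effects by a multiple of [la], uniformly in [z].

   Concatenating stages with summable [la], the Bernstein-Szego densities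
   [1 / |phi_n|^2] converge uniformly along the ends of the stages to a density
   [w] with values in [[1/2, 2]], and [w dm] is the required measure.  The
   orthogonality relations for the Bernstein-Szego densities need no complex
   analysis: by the recursion and a Neumann series, [1 / Phi_n^*] is a uniform
   limit of polynomials on the circle. *)

Set Implicit Arguments.
Unset Strict Implicit.
Unset Printing Implicit Defensive.

Import Order.TTheory GRing.Theory Num.Theory.
Import numFieldNormedType.Exports.
Local Open Scope classical_set_scope.
Local Open Scope complex_scope.
Local Open Scope ring_scope.

(** * Real parts, imaginary parts and moduli of complex numbers *)

Section ComplexModulus.
Variable R : realType.
Implicit Types (x y z : R[i]) (r : R).

Lemma ReD x y : complex.Re (x + y) = complex.Re x + complex.Re y.
Proof. by case: x; case: y. Qed.

Lemma ImD x y : complex.Im (x + y) = complex.Im x + complex.Im y.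
Proof. by case: x; case: y. Qed.

Lemma ReN x : complex.Re (- x) = - complex.Re x.
Proof. by case: x. Qed.

Lemma ImN x : complex.Im (- x) = - complex.Im x.
Proof. by case: x. Qed.

Lemma ReM x y : complex.Re (x * y) =
  complex.Re x * complex.Re y - complex.Im x * complex.Im y.
Proof. by case: x; case: y. Qed.

Lemma ImM x y : complex.Im (x * y) =
  complex.Re x * complex.Im y + complex.Im x * complex.Re y.
Proof. by case: x; case: y. Qed.

Lemma ReJ x : complex.Re (conjc x) = complex.Re x.
Proof. by case: x. Qed.

Lemma ImJ x : complex.Im (conjc x) = - complex.Im x.
Proof. by case: x. Qed.

Lemma Re_sum (I : Type) (s : seq I) (P : pred I) (F : I -> R[i]) :
  complex.Re (\sum_(i <- s | P i) F i) = \sum_(i <- s | P i) complex.Re (F i).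
Proof. by apply: big_morph => //; exact: ReD. Qed.

Lemma Im_sum (I : Type) (s : seq I) (P : pred I) (F : I -> R[i]) :
  complex.Im (\sum_(i <- s | P i) F i) = \sum_(i <- s | P i) complex.Im (F i).
Proof. by apply: big_morph => //; exact: ImD. Qed.

Lemma complex_eq x y :
  complex.Re x = complex.Re y -> complex.Im x = complex.Im y -> x = y.
Proof. by case: x => a b; case: y => c d /= -> ->. Qed.

Lemma cnorm_ge0 x : 0 <= cnorm x.
Proof. by case: x => a b; exact: sqrtr_ge0. Qed.

Lemma cnorm_sqr x : cnorm x ^+ 2 = complex.Re x ^+ 2 + complex.Im x ^+ 2.
Proof. by case: x => a b; rewrite /cnorm /= sqr_sqrtr ?addr_ge0 ?sqr_ge0. Qed.

Lemma cnorm0 : cnorm (0 : R[i]) = 0.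
Proof. exact: ComplexField.Normc.normc0. Qed.

Lemma cnorm1 : cnorm (1 : R[i]) = 1.
Proof. exact: ComplexField.Normc.normc1. Qed.

Lemma cnormM x y : cnorm (x * y) = cnorm x * cnorm y.
Proof. exact: ComplexField.Normc.normcM. Qed.

Lemma cnormV x : cnorm x^-1 = (cnorm x)^-1.
Proof. exact: ComplexField.Normc.normcV. Qed.

Lemma cnormD x y : cnorm (x + y) <= cnorm x + cnorm y.
Proof. exact: le_normcD. Qed.

Lemma cnormN x : cnorm (- x) = cnorm x.
Proof. exact: normcN. Qed.

Lemma cnormB x y : cnorm (x - y) <= cnorm x + cnorm y.
Proof. by rewrite -(cnormN y) cnormD. Qed.

Lemma cnormBC x y : cnorm (x - y) = cnorm (y - x).
Proof. by rewrite -cnormN opprB. Qed.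

Lemma cnorm_eq0 x : (cnorm x == 0) = (x == 0).
Proof.
by apply/eqP/eqP => [/ComplexField.Normc.eq0_normc //|->]; exact: cnorm0.
Qed.

Lemma cnorm_gt0 x : (0 < cnorm x) = (x != 0).
Proof. by rewrite lt_neqAle cnorm_ge0 andbT eq_sym cnorm_eq0. Qed.

Lemma cnormJ x : cnorm (conjc x) = cnorm x.
Proof. by case: x => a b; rewrite /cnorm /= sqrrN. Qed.

Lemma cnormX x n : cnorm (x ^+ n) = cnorm x ^+ n.
Proof. by elim: n => [|n IHn]; rewrite ?cnorm1 // !exprS cnormM IHn. Qed.

Lemma cnormR r : cnorm r%:C = `|r|.
Proof. by rewrite /cnorm /= expr0n addr0 sqrtr_sqr. Qed.

Lemma cnorm_i : cnorm ('i : R[i]) = 1.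
Proof. by rewrite /cnorm /= expr0n add0r expr1n sqrtr1. Qed.

Lemma cnorm_triangle x y z : cnorm (x - z) <= cnorm (x - y) + cnorm (y - z).
Proof. by have -> : x - z = (x - y) + (y - z); [ring|exact: cnormD]. Qed.

Lemma cnorm_diff x y : cnorm x - cnorm y <= cnorm (x - y).
Proof. by rewrite lerBlDr; have := cnormD (x - y) y; rewrite subrK. Qed.

Lemma cnorm_sum (I : Type) (s : seq I) (P : pred I) (F : I -> R[i]) :
  cnorm (\sum_(i <- s | P i) F i) <= \sum_(i <- s | P i) cnorm (F i).
Proof.
apply: (big_ind2 (fun x a => cnorm x <= a)) => [|x a y b Hx Hy|i _ //].
  by rewrite cnorm0.
exact: le_trans (cnormD _ _) (lerD Hx Hy).
Qed.

Lemma ler_Re_cnorm x : `|complex.Re x| <= cnorm x.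
Proof.
rewrite -(ler_pXn2r (n := 2)) ?nnegrE ?cnorm_ge0 // cnorm_sqr real_normK //.
  by rewrite lerDl sqr_ge0.
exact: num_real.
Qed.

Lemma ler_Im_cnorm x : `|complex.Im x| <= cnorm x.
Proof.
rewrite -(ler_pXn2r (n := 2)) ?nnegrE ?cnorm_ge0 // cnorm_sqr real_normK //.
  by rewrite lerDr sqr_ge0.
exact: num_real.
Qed.

Lemma complex_decomp x : x = (complex.Re x)%:C + 'i * (complex.Im x)%:C.
Proof. by case: x => a b; apply: complex_eq; rewrite /=; ring. Qed.

Lemma cnorm_le_ReIm x : cnorm x <= `|complex.Re x| + `|complex.Im x|.
Proof.
rewrite {1}(complex_decomp x); apply: le_trans (cnormD _ _) _.
by rewrite cnormM cnorm_i mul1r !cnormR.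
Qed.

Lemma mulrJ x : x * conjc x = (cnorm x ^+ 2)%:C.
Proof.
rewrite cnorm_sqr; case: x => a b; apply: complex_eq => /=; ring.
Qed.

Lemma invc_circle x : cnorm x = 1 -> x^-1 = conjc x.
Proof.
move=> x1; have x0 : x != 0 by rewrite -cnorm_gt0 x1.
by apply: (mulfI x0); rewrite mulfV // mulrJ x1 expr1n.
Qed.

Lemma conjcM x y : conjc (x * y) = conjc x * conjc y.
Proof. exact: rmorphM. Qed.

Lemma conjcD x y : conjc (x + y) = conjc x + conjc y.
Proof. exact: rmorphD. Qed.

Lemma conjcB x y : conjc (x - y) = conjc x - conjc y.
Proof. exact: rmorphB. Qed.

Lemma unitJ x n : cnorm x = 1 -> x ^+ n * conjc (x ^+ n) = 1.
Proof. by move=> x1; rewrite mulrJ cnormX x1 !expr1n. Qed.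

End ComplexModulus.

(** * The parametrization of the circle by the angle *)

Section CircleParametrization.
Variable R : realType.
Implicit Types (x y t : R) (z : R[i]).

Lemma eTD x y : eT (x + y) = eT x * eT y.
Proof.
apply: complex_eq => /=; rewrite mulrDr ?cosD ?sinD; first by [].
by rewrite addrC; ring.
Qed.

Lemma eT0 : eT (0 : R) = 1.
Proof. by rewrite /eT mulr0 cos0 sin0. Qed.

Lemma cnorm_eT x : cnorm (eT x) = 1.
Proof. by rewrite /cnorm /= cos2Dsin2 sqrtr1. Qed.

Lemma eTN x : eT (- x) = conjc (eT x).
Proof. by rewrite /eT /= mulrN cosN sinN. Qed.

Lemma eTX x n : eT x ^+ n = eT (n%:R * x).
Proof.
elim: n => [|n IHn]; first by rewrite mul0r eT0.
by rewrite exprS IHn -eTD -natr1 mulrDl mul1r addrC.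
Qed.

Lemma eT1 : eT (1 : R) = 1.
Proof. by rewrite /eT mulr1 mulr_natl cos2pi sin2pi. Qed.

Lemma eT_nat n : eT (n%:R : R) = 1.
Proof. by rewrite -[n%:R]mulr1 -eTX eT1 expr1n. Qed.

Lemma eT_neq1 t : 0 < t < 1 -> eT t != 1.
Proof.
move=> /andP[t0 t1]; apply/eqP => /(congr1 (@complex.Re R)) /=.
have -> : 2 * pi * t = (pi * t) *+ 2 :> R by ring.
rewrite cos_mulr2n cos2sin2 => E.
suff : 0 < sin (pi * t :> R) by nra.
by apply: sin_gt0_pi; rewrite mulr_gt0 ?pi_gt0 //= gtr_pMr ?pi_gt0.
Qed.

Lemma eT_surj z : cnorm z = 1 -> exists2 x, 0 <= x < 1 & z = eT x.
Proof.
case: z => a b z1.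
have ab1 : a ^+ 2 + b ^+ 2 = 1.
  by have := cnorm_sqr (a +i* b); rewrite z1 expr1n /=.
have a11 : -1 <= a <= 1 by apply/andP; split; nra.
have pi0 := @pi_gt0 R.
have s2 : sin (acos a) = `|b|.
  by rewrite sin_acos // -sqrtr_sqr; congr Num.sqrt; lra.
have c2 : cos (acos a) = a by rewrite acosK // in_itv.
have ac0 := acos_ge0 a11; have acpi := acos_lepi a11.
have [b0|b0] := leP 0 b.
  exists (acos a / (2 * pi)).
    by rewrite divr_ge0 //= ?ltr_pdivrMr; lra.
  have e : 2 * pi * (acos a / (2 * pi)) = acos a.
    by rewrite mulrC divfK // lt0r_neq0 //; lra.
  by rewrite /eT e c2 s2 ger0_norm.
(* In the lower half circle [b < 0] forces [a < 1], so [acos a] is positive and the angle stays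
   below 1. *)
exists (1 - acos a / (2 * pi)).
  have : 0 < acos a / (2 * pi).
    rewrite divr_gt0; [lra| |lra].
    by rewrite acos_gt0 //; apply/andP; split; nra.
  have : acos a / (2 * pi) < 1 by rewrite ltr_pdivrMr; lra.
  by move=> ? ?; apply/andP; split; lra.
rewrite eTD eT1 mul1r eTN.
have e : 2 * pi * (acos a / (2 * pi)) = acos a.
  by rewrite mulrC divfK // lt0r_neq0 //; lra.
by rewrite /eT e c2 s2 /= ltr0_norm // opprK.
Qed.

End CircleParametrization.

(** * One block of the recursion: summation by parts and the enclosed area *)

Section Block.
Variable R : realType.
Implicit Types (a v : nat -> R[i]) (N : nat) (x : nat -> R).

(** Cauchy-Schwarz against the constant 1. In the inductive step, [n] times the gap is at least the
    square of [s - n * x]. *)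
Lemma sqr_sum_le x N : (\sum_(j < N) x j) ^+ 2 <= N%:R * \sum_(j < N) x j ^+ 2.
Proof.
elim: N => [|N IHN]; first by rewrite !big_ord0 mul0r expr0n.
rewrite !big_ord_recr /= -natr1.
set s := \sum_(i < N) x i in IHN *; set t := \sum_(i < N) _ in IHN *.
case: N @s @t IHN => [|N] s t IHN.
  by rewrite /s /t !big_ord0; lra.
have N0 : 0 < N.+1%:R :> R by rewrite ltr0n.
have : 0 <= (s - N.+1%:R * x N.+1) ^+ 2 by exact: sqr_ge0.
set n := N.+1%:R in IHN N0 * => H.
suff : 0 <= n * (t + n * x N.+1 ^+ 2 - 2 * s * x N.+1).
  by rewrite pmulr_rge0 //; nra.
nra.
Qed.

(** Each step multiplies the modulus by at most [1 + cnorm (a j)]. While the sum of the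
    [cnorm (a j)] is at most 1/2, the product of these factors is at most 1 plus twice the sum. *)
Lemma block_growth a v N :
  (forall m, (m < N)%N -> v m.+1 = v m + a m * conjc (v m)) ->
  \sum_(j < N) cnorm (a j) <= 2^-1 ->
  forall m, (m <= N)%N -> cnorm (v m) <= 2 * cnorm (v 0%N).
Proof.
move=> vS aN.
have aM m : (m <= N)%N -> \sum_(j < m) cnorm (a j) <= 2^-1.
  move=> mN; apply: le_trans aN; rewrite -(subnKC mN) big_split_ord /= lerDl.
  by apply: sumr_ge0 => j _; exact: cnorm_ge0.
have H m : (m <= N)%N ->
    cnorm (v m) <= (1 + 2 * \sum_(j < m) cnorm (a j)) * cnorm (v 0%N).
  elim: m => [|m IHm] mN; first by rewrite big_ord0 mulr0 addr0 mul1r.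
  rewrite vS //; apply: le_trans (cnormD _ _) _; rewrite cnormM cnormJ.
  have := IHm (ltnW mN); have := aM _ (ltnW mN); rewrite big_ord_recr /=.
  have s0 : 0 <= \sum_(j < m) cnorm (a j).
    by apply: sumr_ge0 => j _; exact: cnorm_ge0.
  have := cnorm_ge0 (a m); have := cnorm_ge0 (v 0%N); have := cnorm_ge0 (v m).
  move: s0; set s := \sum_(j < m) _; set b := cnorm (a m).
  set y := cnorm (v 0%N); set w := cnorm (v m) => s0 w0 y0 b0 s2 wy.
  have : w + b * w <= (1 + b) * ((1 + 2 * s) * y) by nra.
  have := mulr_ge0 b0 y0; set by_ := b * y => h1 h2.
  have : 0 <= by_ * (1 - 2 * s) by apply: mulr_ge0 => //; lra.
  rewrite /by_; lra.
move=> m mN; apply: le_trans (H m mN) _; apply: ler_wpM2r; first exact: cnorm_ge0.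
by have := aM m mN; lra.
Qed.

(** Summation by parts applied to the increments [a j * conjc (v j)]: the differences of
    [conjc (v j)] are again given by the recursion, as [conjc (a j) * v j]. *)
Lemma block_by_parts a v N :
  (forall m, (m < N)%N -> v m.+1 = v m + a m * conjc (v m)) ->
  forall m, (m <= N)%N -> v m - v 0%N =
    (\sum_(j < m) a j) * conjc (v m)
    - \sum_(j < m) conjc (a j) * (\sum_(i < j.+1) a i) * v j.
Proof.
move=> vS; elim => [|m IHm] mN; first by rewrite !big_ord0 mul0r !subrr.
have /eqP := IHm (ltnW mN); rewrite subr_eq => /eqP IH.
rewrite !big_ord_recr /= vS // conjcD conjcM conjcK {1}IH; ring.
Qed.

(** With [A] the partial sums, the real part telescopes, because it is half of the increment of
    [cnorm A ^+ 2] plus half of [cnorm (a j) ^+ 2]. The imaginary part is, up to sign, twice the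
    area enclosed by the path [A]. *)
Lemma block_phase a N :
  \sum_(j < N) conjc (a j) * (\sum_(i < j.+1) a i) =
  ((cnorm (\sum_(j < N) a j) ^+ 2 + \sum_(j < N) cnorm (a j) ^+ 2) / 2)%:C +
  'i * (\sum_(j < N) complex.Im (conjc (a j) * \sum_(i < j) a i))%:C.
Proof.
apply: complex_eq.
  rewrite Re_sum ReD ReM /= !mul0r !mulr0 !subrr addr0.
  elim: N => [|N IHN]; first by rewrite !big_ord0 cnorm0 expr0n /= addr0 mul0r.
  rewrite big_ord_recr /= IHN !big_ord_recr /= !cnorm_sqr !ReM !ReJ !ImJ !ReD !ImD.
  by field.
rewrite Im_sum ImD ImM /= !mul0r mul1r !add0r.
apply: eq_bigr => j _; rewrite big_ord_recr /= mulrDr ImD.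
by rewrite [conjc _ * a j]mulrC mulrJ /= addr0.
Qed.

(** In the summation by parts, freezing [v j] at [v 0] leaves the rotation by [tau]. The error
    consists of the end point [A N], the real part found in [block_phase], and the drift of [v j],
    which is itself of the order of [A j] plus [S]. Cauchy-Schwarz bounds [S], and with it [tau], by
    the energy [B]. *)
Lemma block_step a v N (e : R) :
  (forall m, (m < N)%N -> v m.+1 = v m + a m * conjc (v m)) ->
  (forall m, (m < N)%N -> cnorm (a m) <= e) -> N%:R * e <= 2^-1 ->
  let A m := \sum_(j < m) a j in
  let B := \sum_(j < N) cnorm (A j.+1) ^+ 2 in
  let tau := \sum_(j < N) complex.Im (conjc (a j) * A j) in
  cnorm (v N - v 0%N * (1 - 'i * tau%:C)) <=
    cnorm (v 0%N) * (3 * cnorm (A N) + 2 * e * B + 2 * e ^+ 2 * N%:R * B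
                     + N%:R * e ^+ 2)
  /\ tau ^+ 2 <= e ^+ 2 * N%:R * B.
Proof.
move=> vS ae Ne A B tau.
case: N => [|N] in vS ae Ne A B tau *.
  rewrite /tau /B /A !big_ord0 !cnorm0 mulr0 subr0 mulr1 subrr cnorm0 expr0n /=.
  by split; lra.
have e0 : 0 <= e by apply: le_trans (ae 0%N isT); exact: cnorm_ge0.
have suma : \sum_(j < N.+1) cnorm (a j) <= 2^-1.
  apply: le_trans Ne; apply: le_trans (ler_sum _ (fun j _ => ae _ (ltn_ord j))) _.
  by rewrite sumr_const card_ord mulr_natl.
have v2 := block_growth vS suma.
have parts m : (m <= N.+1)%N -> v m - v 0%N = A m * conjc (v m)
    - \sum_(j < m) conjc (a j) * A j.+1 * v j by exact: block_by_parts.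
pose S := \sum_(j < N.+1) cnorm (a j) * cnorm (A j.+1).
have B0 : 0 <= B by apply: sumr_ge0 => j _; exact: sqr_ge0.
have S0 : 0 <= S by apply: sumr_ge0 => j _; rewrite mulr_ge0 ?cnorm_ge0.
have SB : S ^+ 2 <= e ^+ 2 * N.+1%:R * B.
  have SA : S <= e * \sum_(j < N.+1) cnorm (A j.+1).
    rewrite mulr_sumr; apply: ler_sum => j _.
    by rewrite ler_wpM2r ?cnorm_ge0 ?ae.
  have := sqr_sum_le (fun j => cnorm (A j.+1)) N.+1; rewrite -/B => H.
  apply: (@le_trans _ _ ((e * \sum_(j < N.+1) cnorm (A j.+1)) ^+ 2)).
    by rewrite ler_pXn2r // ?nnegrE // (le_trans S0).
  by rewrite exprMn -mulrA ler_wpM2l ?sqr_ge0.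
pose Q := \sum_(j < N.+1) conjc (a j) * A j.+1.
have QE : Q = _ := block_phase a N.+1; rewrite -/A -/tau in QE.
have QS : cnorm Q <= S.
  apply: le_trans (cnorm_sum _ _ _) _; apply: ler_sum => j _.
  by rewrite cnormM cnormJ.
have tauS : `|tau| <= S.
  apply: le_trans QS; suff -> : tau = complex.Im Q by exact: ler_Im_cnorm.
  by rewrite QE ImD ImM /= !mul0r mul1r !add0r.
split; last first.
  apply: le_trans SB; rewrite -[tau ^+ 2]real_normK ?num_real //.
  by rewrite ler_pXn2r // ?nnegrE.
have AN : cnorm (A N.+1) <= 2^-1.
  by apply: le_trans (cnorm_sum _ _ _) _.
have dv m : (m <= N.+1)%N ->
    cnorm (v m - v 0%N) <= 2 * cnorm (v 0%N) * (cnorm (A m) + S).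
  move=> mN; rewrite parts //; apply: le_trans (cnormB _ _) _.
  rewrite mulrDr; apply: lerD.
    rewrite cnormM cnormJ mulrC; apply: ler_wpM2r; first exact: cnorm_ge0.
    exact: v2.
  apply: le_trans (cnorm_sum _ _ _) _; rewrite /S mulr_sumr.
  apply: (@le_trans _ _ (\sum_(j < m)
      2 * cnorm (v 0%N) * (cnorm (a j) * cnorm (A j.+1)))).
    apply: ler_sum => j _; rewrite !cnormM cnormJ mulrC.
    apply: ler_wpM2r; first by rewrite mulr_ge0 ?cnorm_ge0.
    by apply: v2; apply: leq_trans (ltnW (ltn_ord j)) mN.
  rewrite -(subnKC mN) big_split_ord /= lerDl; apply: sumr_ge0 => j _.
  by rewrite !mulr_ge0 ?cnorm_ge0.
(* The product of two consecutive moduli is at most the mean of their squares. *)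
have AA : \sum_(j < N.+1) cnorm (a j) * cnorm (A j.+1) * cnorm (A j) <= e * B.
  have B' : \sum_(j < N.+1) cnorm (A j) ^+ 2 <= B.
    rewrite /B [X in X <= _]big_ord_recl /= /A big_ord0 cnorm0 expr0n add0r.
    rewrite [X in _ <= X]big_ord_recr /= lerDl; exact: sqr_ge0.
  apply: (@le_trans _ _ (e * \sum_(j < N.+1)
      (cnorm (A j.+1) ^+ 2 + cnorm (A j) ^+ 2) / 2)).
    rewrite mulr_sumr; apply: ler_sum => j _; rewrite -mulrA; apply: ler_pM => //.
    - exact: cnorm_ge0.
    - by rewrite mulr_ge0 ?cnorm_ge0.
    - exact: ae.
    - by have := sqr_ge0 (cnorm (A j.+1) - cnorm (A j)); lra.
  by apply: ler_wpM2l => //; rewrite -mulr_suml big_split /= -/B; lra.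
(* Splitting [v j] as [v 0] plus the drift makes [Q * v 0] appear, whose imaginary part is exactly
   the rotation subtracted on the left. *)
have -> : v N.+1 - v 0%N * (1 - 'i * tau%:C) = A N.+1 * conjc (v N.+1)
    - (((cnorm (A N.+1) ^+ 2 + \sum_(j < N.+1) cnorm (a j) ^+ 2) / 2)%:C * v 0%N
       + \sum_(j < N.+1) conjc (a j) * A j.+1 * (v j - v 0%N)).
  have -> : \sum_(j < N.+1) conjc (a j) * A j.+1 * (v j - v 0%N) =
      \sum_(j < N.+1) conjc (a j) * A j.+1 * v j - Q * v 0%N.
    rewrite mulr_suml -sumrB; apply: eq_bigr => j _; by rewrite mulrBr.
  have /eqP := parts N.+1 (leqnn _); rewrite subr_eq => /eqP {1}->.
  rewrite QE -/A; ring.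
apply: le_trans (cnormB _ _) _.
have h1 : cnorm (A N.+1 * conjc (v N.+1)) <= cnorm (v 0%N) * (2 * cnorm (A N.+1)).
  rewrite cnormM cnormJ mulrC mulrA ler_wpM2r ?cnorm_ge0 // [_ * 2]mulrC.
  exact: v2.
have h2 : cnorm (\sum_(j < N.+1) conjc (a j) * A j.+1 * (v j - v 0%N)) <=
    cnorm (v 0%N) * (2 * (e * B) + 2 * (e ^+ 2 * N.+1%:R * B)).
  apply: le_trans (cnorm_sum _ _ _) _.
  apply: (@le_trans _ _ (\sum_(j < N.+1) 2 * cnorm (v 0%N) *
     (cnorm (a j) * cnorm (A j.+1) * cnorm (A j) + cnorm (a j) * cnorm (A j.+1) * S))).
    apply: ler_sum => j _; rewrite !cnormM cnormJ -mulrDr mulrCA.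
    apply: ler_wpM2l; first by rewrite mulr_ge0 ?cnorm_ge0.
    by apply: dv; apply: ltnW.
  rewrite -mulr_sumr big_split /= -mulr_suml -/S -expr2.
  rewrite -mulrDr mulrA [cnorm _ * 2]mulrC ler_wpM2l ?mulr_ge0 ?cnorm_ge0 //.
  exact: lerD.
have h3 : cnorm (((cnorm (A N.+1) ^+ 2 + \sum_(j < N.+1) cnorm (a j) ^+ 2) / 2)%:C
    * v 0%N) <= cnorm (v 0%N) * (cnorm (A N.+1) + N.+1%:R * e ^+ 2).
  rewrite cnormM cnormR mulrC ler_wpM2l ?cnorm_ge0 //.
  have Sa : \sum_(j < N.+1) cnorm (a j) ^+ 2 <= N.+1%:R * e ^+ 2.
    rewrite mulr_natl -[X in _ *+ X]card_ord -sumr_const.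
    by apply: ler_sum => j _; rewrite ler_pXn2r ?nnegrE ?cnorm_ge0 ?ae.
  have Sa0 : 0 <= \sum_(j < N.+1) cnorm (a j) ^+ 2.
    by apply: sumr_ge0 => j _; exact: sqr_ge0.
  have An := cnorm_ge0 (A N.+1).
  rewrite ger0_norm; first by nra.
  by rewrite divr_ge0 // addr_ge0 ?sqr_ge0.
have h4 := cnormD (((cnorm (A N.+1) ^+ 2 + \sum_(j < N.+1) cnorm (a j) ^+ 2) / 2)%:C
    * v 0%N) (\sum_(j < N.+1) conjc (a j) * A j.+1 * (v j - v 0%N)).
apply: le_trans (lerD h1 (le_trans h4 (lerD h3 h2))) _.
by rewrite -!mulrDr ler_wpM2l ?cnorm_ge0 //; lra.
Qed.

End Block.

(** * Products of near rotations: stability of the modulus and motion of the argument *)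

Section NearRotations.
Variable R : realType.
Implicit Types (V : nat -> R[i]) (tau E : nat -> R) (n : nat).

Lemma cnorm_rotation (t : R) : 1 <= cnorm (1 - 'i * t%:C) <= 1 + t ^+ 2.
Proof.
have E : cnorm (1 - 'i * t%:C) ^+ 2 = 1 + t ^+ 2.
  by rewrite cnorm_sqr ReD ImD ReN ImN ReM ImM /=; ring.
have := cnorm_ge0 (1 - 'i * t%:C); have := sqr_ge0 t.
move: E; set y := cnorm _; set x := t ^+ 2 => E x0 y0.
by apply/andP; split; nra.
Qed.

(** A factor [1 - 'i * t] changes lengths only to second order in [t], so each step changes the
    modulus by a relative amount of at most [E k + tau k ^+ 2]. The bound 1/4 on the total allows
    the product of these changes to be replaced by their sum. *)
Lemma near_rotations_modulus V tau E n :
  (forall k, (k < n)%N -> 0 <= E k) ->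
  (forall k, (k < n)%N ->
     cnorm (V k.+1 - V k * (1 - 'i * (tau k)%:C)) <= cnorm (V k) * E k) ->
  \sum_(k < n) (E k + tau k ^+ 2) <= 4^-1 ->
  forall k, (k <= n)%N ->
    (1 - \sum_(k < n) (E k + tau k ^+ 2)) * cnorm (V 0%N) <= cnorm (V k) /\
    cnorm (V k) <= (1 + 2 * \sum_(k < n) (E k + tau k ^+ 2)) * cnorm (V 0%N).
Proof.
move=> E0 VE F4.
have FM k : (k <= n)%N -> 0 <= \sum_(j < k) (E j + tau j ^+ 2)
    <= \sum_(j < n) (E j + tau j ^+ 2).
  move=> kn; apply/andP; split.
    by apply: sumr_ge0 => j _; rewrite addr_ge0 ?sqr_ge0 ?E0 // (leq_trans _ kn).
  rewrite -[in X in _ <= X](subnKC kn) big_split_ord /= lerDl.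
  apply: sumr_ge0 => j _; rewrite addr_ge0 ?sqr_ge0 ?E0 //.
  by rewrite -{2}(subnKC kn) ltn_add2l.
have H k : (k <= n)%N ->
    (1 - \sum_(j < k) (E j + tau j ^+ 2)) * cnorm (V 0%N) <= cnorm (V k) /\
    cnorm (V k) <= (1 + 2 * \sum_(j < k) (E j + tau j ^+ 2)) * cnorm (V 0%N).
  elim: k => [|k IHk] kn; first by rewrite big_ord0 subr0 mulr0 addr0 mul1r.
  have [IH1 IH2] := IHk (ltnW kn); have /andP[f0 f1] := FM _ (ltnW kn).
  rewrite big_ord_recr /=.
  have /andP[t1 t2] := cnorm_rotation (tau k).
  have := VE k kn; have Ek := E0 k kn.
  have d1 := cnorm_diff (V k.+1) (V k * (1 - 'i * (tau k)%:C)).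
  have d2 := cnorm_diff (V k * (1 - 'i * (tau k)%:C)) (V k.+1).
  rewrite [X in _ <= X]cnormBC in d2; rewrite cnormM in d1 d2.
  move: d1 d2 t1 t2 IH1 IH2 f0 f1 (sqr_ge0 (tau k)) (cnorm_ge0 (V 0%N)).
  move: (cnorm_ge0 (V k)).
  set r := cnorm (1 - _); set x := cnorm (_ - _); set y := cnorm (V k.+1).
  set w := cnorm (V k); set u := cnorm (V 0%N); set T := tau k ^+ 2.
  set s := \sum_(j < k) _; set e := E k => w0 d1 d2 t1 t2 IH1 IH2 f0 f1 T0 u0 xe.
  have lo : (1 - e - T) * w <= y by nra.
  have hi : y <= (1 + e + T) * w by nra.
  have /andP[_ f2] := FM _ kn; rewrite big_ord_recr /= -/s -/e -/T in f2.
  have eT0 : 0 <= e + T by exact: addr_ge0.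
  split.
    apply: le_trans lo; apply: le_trans (ler_wpM2l _ IH1); last by lra.
    rewrite mulrA ler_wpM2r //; have := mulr_ge0 eT0 f0; lra.
  apply: le_trans hi _; apply: le_trans (ler_wpM2l _ IH2) _; first by lra.
  rewrite mulrA ler_wpM2r //.
  have : (e + T) * s <= (e + T) * 2^-1 by apply: ler_wpM2l => //; lra.
  lra.
move=> k kn; have [H1 H2] := H k kn; have /andP[f0 f1] := FM k kn.
have u0 := cnorm_ge0 (V 0%N).
by split; [apply: le_trans H1|apply: le_trans H2 _]; rewrite ler_wpM2r //; lra.
Qed.

(* If all the [V k] stayed close to [V J1], then the rotations would add up to
   multiplication of [V J1] by a purely imaginary number of size at least 1. *)
Lemma near_rotations_move V tau E n (d : nat -> R) J1 J2 :
  (forall k, (k < n)%N -> 0 <= E k) ->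
  (forall k, (k < n)%N ->
     cnorm (V k.+1 - V k * (1 - 'i * (tau k)%:C)) <= cnorm (V k) * E k) ->
  \sum_(k < n) (E k + tau k ^+ 2) <= 20^-1 ->
  (J1 <= J2 <= n)%N ->
  (forall k, (J1 <= k < J2)%N -> 0 <= d k /\ tau k <= d k) ->
  \sum_(J1 <= k < J2) d k <= 20^-1 ->
  1 <= \sum_(J1 <= k < J2) - tau k ->
  cnorm (V 0%N) != 0 ->
  exists2 k, (J1 <= k <= J2)%N & cnorm (V 0%N) / 10 <= cnorm (V k - V J1).
Proof.
move=> E0 VE F20 /andP[J12 J2n] taud dD tau1 V0.
apply: contrapT => /forall2NP close.
have {}close k : (J1 <= k <= J2)%N -> cnorm (V k - V J1) <= cnorm (V 0%N) / 10.
  by move=> hk; have [//|] := close k; move/negP; rewrite -ltNge => /ltW.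
have F4 : \sum_(k < n) (E k + tau k ^+ 2) <= 4^-1 by lra.
have mods := near_rotations_modulus E0 VE F4.
set F := \sum_(k < n) _ in F20 F4 mods.
have telescope : V J2 - V J1 - 'i * (\sum_(J1 <= k < J2) - tau k)%:C * V J1 =
    \sum_(J1 <= k < J2) ((V k.+1 - V k * (1 - 'i * (tau k)%:C))
      - 'i * (tau k)%:C * (V k - V J1)).
  rewrite -(telescope_sumr V J12) (raddf_sum (real_complex R)) /=.
  rewrite mulr_sumr mulr_suml -sumrB; apply: eq_bigr => k _.
  rewrite (raddfN (real_complex R)) /=; ring.
have bnd : cnorm (V J2 - V J1 - 'i * (\sum_(J1 <= k < J2) - tau k)%:C * V J1) <=
    cnorm (V 0%N) * (\sum_(J1 <= k < J2) (2 * E k + (- tau k + 2 * d k) / 10)).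
  rewrite telescope mulr_sumr; apply: le_trans (cnorm_sum _ _ _) _.
  rewrite !big_nat; apply: ler_sum => k /andP[k1 k2].
  have kn : (k < n)%N by apply: leq_trans J2n.
  apply: le_trans (cnormB _ _) _; rewrite !cnormM cnorm_i mul1r cnormR.
  have [_ m1] := mods k (ltnW kn); have := VE k kn; have := E0 k kn.
  have c1 : cnorm (V k - V J1) <= cnorm (V 0%N) / 10 by apply: close; lia.
  have [d0 td] : 0 <= d k /\ tau k <= d k by apply: taud; lia.
  (* The absolute value is traded for the signed phase plus a summable term, so that the final
     comparison involves only the signed sum [T]. *)
  have tn : `|tau k| <= - tau k + 2 * d k.
    by rewrite ler_norml; apply/andP; split; lra.
  have u0 := cnorm_ge0 (V 0%N).
  have t0 : 0 <= `|tau k| by [].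
  have c2 : `|tau k| * cnorm (V k - V J1) <=
      (- tau k + 2 * d k) * (cnorm (V 0%N) / 10).
    by apply: ler_pM => //; exact: cnorm_ge0.
  move=> e0 ve.
  have : cnorm (V k) * E k <= 2 * cnorm (V 0%N) * E k.
    apply: ler_wpM2r => //; apply: le_trans m1 _; apply: ler_wpM2r => //; lra.
  lra.
have Esum : \sum_(J1 <= k < J2) E k <= F.
  rewrite /F -(big_mkord xpredT (fun k => E k + tau k ^+ 2)).
  rewrite [X in _ <= X](big_cat_nat (n := J2)) //=.
  rewrite [X in _ <= X + _](big_cat_nat (n := J1)) //=.
  have p1 : 0 <= \sum_(0 <= i < J1) (E i + tau i ^+ 2).
    rewrite big_nat; apply: sumr_ge0 => i hi.
    by rewrite addr_ge0 ?sqr_ge0 // E0 //; lia.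
  have p3 : 0 <= \sum_(J2 <= i < n) (E i + tau i ^+ 2).
    rewrite big_nat; apply: sumr_ge0 => i hi.
    by rewrite addr_ge0 ?sqr_ge0 // E0 //; lia.
  have p2 : \sum_(J1 <= k < J2) E k <= \sum_(J1 <= i < J2) (E i + tau i ^+ 2).
    by apply: ler_sum => i _; rewrite lerDl sqr_ge0.
  by rewrite -[X in X <= _]add0r -[X in X <= _]addr0 !lerD.
have low : cnorm (\sum_(J1 <= k < J2) - tau k)%:C * cnorm (V J1) <=
    cnorm (V 0%N) / 10 +
    cnorm (V J2 - V J1 - 'i * (\sum_(J1 <= k < J2) - tau k)%:C * V J1).
  have -> : cnorm (\sum_(J1 <= k < J2) - tau k)%:C * cnorm (V J1) =
      cnorm ('i * (\sum_(J1 <= k < J2) - tau k)%:C * V J1).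
    by rewrite !cnormM cnorm_i mul1r.
  have c1 : cnorm (V J2 - V J1) <= cnorm (V 0%N) / 10.
    by apply: close; rewrite J12 leqnn.
  set W := 'i * _ * _.
  have := cnorm_diff W (V J2 - V J1); rewrite [cnorm (W - _)]cnormBC; lra.
have [m2 _] := mods J1 (leq_trans J12 J2n).
rewrite cnormR in low; move: bnd low.
rewrite big_split /= -mulr_sumr -mulr_suml big_split /= -mulr_sumr.
set T := \sum_(J1 <= k < J2) - tau k in tau1 *.
set D := \sum_(J1 <= k < J2) d k in dD *.
set X := cnorm (_ - _ * _); set ee := \sum_(J1 <= k < J2) E k in Esum *.
have u0 : 0 < cnorm (V 0%N) by rewrite lt_neqAle eq_sym V0 cnorm_ge0.
rewrite ger0_norm; last by lra.
set u := cnorm (V 0%N) in u0 m2 *; set w := cnorm (V J1) in m2 *.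
move=> h1 h2.
(* The estimates combine to [19/20 * T <= 21/100 + T/10], which is impossible for [1 <= T]. *)
have h3 : T * ((19 / 20) * u) <= T * w.
  by apply: ler_wpM2l; [lra|apply: le_trans m2; rewrite ler_wpM2r; lra].
have h4 : u * (2 * ee + (T + 2 * D) / 10) <= u * (10^-1 + (T + 10^-1) / 10).
  by apply: ler_wpM2l; lra.
have h5 : u * 1 <= u * T by apply: ler_wpM2l; lra.
lra.
Qed.

End NearRotations.

(** * Orthogonality and Parseval's identity over the roots of unity *)

Section RootsOfUnity.
Variable R : realType.
Implicit Types (x t : R) (c : nat -> R) (K M m d k : nat).

(** A geometric sum whose ratio is a [K]-th root of unity; the range of [d] makes the ratio
    different from 1. *)
Lemma sum_eT_eq0 x K d : (0 < d < K)%N ->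
  \sum_(k < K) eT (d%:R * (x - k%:R / K%:R)) = 0 :> R[i].
Proof.
move=> /andP[d0 dK].
have K0 : 0 < K%:R :> R by rewrite ltr0n (leq_ltn_trans _ dK).
pose r : R[i] := eT (- (d%:R / K%:R)).
have r1 : r - 1 != 0.
  rewrite subr_eq0 /r eTN -(inj_eq (can_inj (@conjcK _))) conjcK conjc1.
  apply: eT_neq1; apply/andP; split; first by rewrite divr_gt0 // ltr0n.
  by rewrite ltr_pdivrMr // mul1r ltr_nat.
have -> : \sum_(k < K) eT (d%:R * (x - k%:R / K%:R)) =
    eT (d%:R * x) * \sum_(k < K) r ^+ k.
  rewrite mulr_sumr; apply: eq_bigr => k _.
  by rewrite /r eTX -eTD; congr eT; ring.
suff -> : \sum_(k < K) r ^+ k = 0 by rewrite mulr0.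
apply: (mulfI r1); rewrite mulr0 -subrX1 /r eTX mulrN mulrCA divff ?gt_eqF //.
by rewrite mulr1 eTN eT_nat conjc1 subrr.
Qed.

Lemma sum_eTX_conj x K m1 m2 : (m1 < K)%N -> (m2 < K)%N ->
  \sum_(k < K) eT (x - k%:R / K%:R) ^+ m1 * conjc (eT (x - k%:R / K%:R) ^+ m2)
  = (if m1 == m2 then K%:R else 0) :> R[i].
Proof.
wlog lem : m1 m2 / (m2 <= m1)%N => [W|] h1 h2.
  have [/W|/ltnW/W/(_ h2 h1) E] := leqP m2 m1; first exact.
  rewrite eq_sym; move/(congr1 (@conjc R)): E; rewrite rmorph_sum /=.
  rewrite (_ : conjc (if _ then _ else _) = if m2 == m1 then K%:R else 0).
    by move=> <-; apply: eq_bigr => k _; rewrite conjcM conjcK mulrC.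
  by case: ifP => _; rewrite ?conjc_nat ?conjc0.
have E k : eT (x - k%:R / K%:R) ^+ m1 * conjc (eT (x - k%:R / K%:R) ^+ m2) =
    eT ((m1 - m2)%:R * (x - k%:R / K%:R)).
  rewrite -{1}(subnK lem) exprD -mulrA unitJ ?mulr1 ?eTX //; exact: cnorm_eT.
under eq_bigr do rewrite E.
case: eqP => [->|/eqP ne].
  under eq_bigr do rewrite subnn mul0r eT0.
  by rewrite sumr_const card_ord.
by apply: sum_eT_eq0; lia.
Qed.

(** Since [M <= K], the exponents are distinct modulo [K], so that only the diagonal terms of the
    expanded square survive. *)
Lemma parseval_roots x c K M : (M <= K)%N ->
  \sum_(k < K) cnorm (\sum_(m < M) (c m)%:C * eT (x - k%:R / K%:R) ^+ m) ^+ 2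
  = K%:R * \sum_(m < M) c m ^+ 2.
Proof.
move=> MK; apply: (@complexI R).
rewrite (raddf_sum (real_complex R)) /=.
have E k : (cnorm (\sum_(m < M) (c m)%:C * eT (x - k%:R / K%:R) ^+ m) ^+ 2)%:C =
    \sum_(m1 < M) \sum_(m2 < M) (c m1)%:C * (c m2)%:C *
      (eT (x - k%:R / K%:R) ^+ m1 * conjc (eT (x - k%:R / K%:R) ^+ m2)).
  rewrite -mulrJ mulr_suml; apply: eq_bigr => m1 _.
  rewrite (raddf_sum (@conjc R)) mulr_sumr; apply: eq_bigr => m2 _.
  by rewrite /= conjcM conjc_real; ring.
under eq_bigr do rewrite E.
rewrite exchange_big /= (rmorphM (real_complex R)) rmorph_sum mulr_sumr /=.
apply: eq_bigr => m1 _; rewrite exchange_big /= (bigD1 m1) //= [X in _ + X]big1.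
  rewrite -mulr_sumr sum_eTX_conj ?eqxx ?(leq_trans (ltn_ord _) MK) //.
  by rewrite rmorph_nat rmorphXn /= addr0; ring.
move=> m2 ne; rewrite -mulr_sumr sum_eTX_conj ?(leq_trans (ltn_ord _) MK) //.
by rewrite eq_sym (inj_eq val_inj) (negbTE ne) mulr0.
Qed.

End RootsOfUnity.

(* Coefficients of [(1 + X + ... + X^(L-1)) ^ 2]. *)
Definition tri (L m : nat) : nat := minn m.+1 (2 * L - m.+1).

(** * Closed forms for the partial sums of the triangular profile *)

Section Triangular.
Variable F : idomainType.
Implicit Types (u : F) (L m : nat).

(** Multiplication by [(u - 1) ^+ 2] avoids denominators, so that the formula also makes sense for a
    polynomial variable [u]. This is the rising half of the profile; the next lemma treats the
    falling half. *)
Lemma tri_partial_up u L m : (m <= L)%N ->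
  (u - 1) ^+ 2 * (\sum_(j < m) (tri L j)%:R * u ^+ j) =
  (u - 1) * (m%:R * u ^+ m) - (u ^+ m - 1).
Proof.
elim: m => [|m IHm] mL; first by rewrite big_ord0 mul0r expr0 subrr !mulr0 subrr.
rewrite big_ord_recr /= mulrDr IHm ?(ltnW mL) //.
have -> : tri L m = m.+1 by rewrite /tri; lia.
by rewrite [u ^+ m.+1]exprS -natr1; ring.
Qed.

Lemma tri_partial_down u L j : (j <= L)%N ->
  (u - 1) ^+ 2 * (\sum_(i < L + j) (tri L i)%:R * u ^+ i) =
  (u - 1) * ((L - j)%:R * u ^+ (L + j)) - (2 * u ^+ L - 1 - u ^+ (L + j)).
Proof.
elim: j => [|j IHj] jL.
  by rewrite addn0 tri_partial_up // subn0; ring.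
rewrite addnS big_ord_recr /= mulrDr IHj ?(ltnW jL) //.
have -> : tri L (L + j) = (L - j.+1)%N by rewrite /tri; lia.
have -> : (L - j = (L - j.+1).+1)%N by lia.
by rewrite [u ^+ (L + j).+1]exprS -natr1; ring.
Qed.

End Triangular.

(** Cancelling [(u - 1) ^+ 2] is legitimate for the indeterminate; evaluation then gives the
    identity everywhere, including at [u = 1]. *)
Lemma tri_sum (F : idomainType) (u : F) L :
  \sum_(m < L + L) (tri L m)%:R * u ^+ m = (\sum_(i < L) u ^+ i) ^+ 2.
Proof.
have : \sum_(m < L + L) (tri L m)%:R * 'X ^+ m =
    (\sum_(i < L) 'X ^+ i) ^+ 2 :> {poly F}.
  have X1 : ('X - 1 : {poly F}) ^+ 2 != 0.
    by rewrite expf_neq0 // -polyC1 polyXsubC_eq0.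
  apply: (mulfI X1); rewrite tri_partial_down // subnn -exprMn -subrX1 exprD.
  by ring.
move/(congr1 (horner^~ u)); rewrite horner_exp !horner_sum.
under eq_bigr do rewrite hornerM hornerXn -polyC_natr hornerC.
by under [in X in _ = X -> _]eq_bigr do rewrite hornerXn.
Qed.

Lemma tri_le L m : (tri L m <= L)%N.
Proof. by rewrite /tri; lia. Qed.

(** * The rotation produced by a triangular block near its resonance *)

Section BlockPhase.
Variable R : realType.
Implicit Types (L i : nat) (t y : R) (u : R[i]).

Lemma sum_tri L : \sum_(m < L + L) (tri L m)%:R = L%:R ^+ 2 :> R.
Proof.
have := tri_sum (1 : R) L.
under eq_bigr do rewrite expr1n mulr1.
by under [in X in _ = X -> _]eq_bigr do rewrite expr1n; rewrite sumr_const card_ord.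
Qed.

(** The coefficient that precedes [tri L m], equal to 0 at [m = 0]. It is the weight of the leading
    term, of order [(u - 1)^-1], in the sum of the first [m] terms of the profile. *)
Definition tri_prev L m : nat := minn m (2 * L - m).

(** The rising half alone contributes [(L^3 - L) / 3], which is at least [L^3 / 4] once [2 <= L]. *)
Lemma sum_tri_prev L : (2 <= L)%N ->
  L%:R ^+ 3 / 4 <= \sum_(m < L + L) (tri L m)%:R * (tri_prev L m)%:R :> R.
Proof.
move=> L2.
have H m : (m <= L)%N -> (m%:R ^+ 3 - m%:R) / 3 =
    \sum_(j < m) (tri L j)%:R * (tri_prev L j)%:R :> R.
  elim: m => [|m IHm] mL; first by rewrite big_ord0 expr0n /= subrr mul0r.
  rewrite big_ord_recr /= -IHm ?(ltnW mL) //.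
  have -> : tri L m = m.+1 by rewrite /tri; lia.
  have -> : tri_prev L m = m by rewrite /tri_prev; lia.
  by rewrite -natr1; field.
rewrite big_split_ord /= -H //.
have : 0 <= \sum_(i < L) (tri L (L + i))%:R * (tri_prev L (L + i))%:R :> R.
  by apply: sumr_ge0 => j _; rewrite mulr_ge0.
have : 2 <= L%:R :> R by rewrite ler_nat.
set l := L%:R => l2; have : 0 <= l * (l ^+ 2 - 4) by rewrite mulr_ge0; nra.
lra.
Qed.

(** By the closed forms, each partial sum is [tri_prev L j * u ^+ j / (u - 1)] minus a bounded [f j]
    over [(u - 1) ^+ 2]. In the first term [u ^+ j] cancels against its conjugate, so the
    contributions add up without oscillation. *)
Lemma sum_tri_phase L u : cnorm u = 1 -> u != 1 ->
  exists2 f : nat -> R[i], (forall j, cnorm (f j) <= 4) &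
  \sum_(j < L + L) ((tri L j)%:R * conjc (u ^+ j)) *
     (\sum_(i < j) (tri L i)%:R * u ^+ i) =
  (\sum_(j < L + L) (tri L j)%:R * (tri_prev L j)%:R) / (u - 1)
  - (\sum_(j < L + L) (tri L j)%:R * conjc (u ^+ j) * f j) / (u - 1) ^+ 2.
Proof.
move=> u1 une; have ne : u - 1 != 0 by rewrite subr_eq0.
pose f j : R[i] := if (j <= L)%N then u ^+ j - 1 else 2 * u ^+ L - 1 - u ^+ j.
have cX n : cnorm (u ^+ n) = 1 by rewrite cnormX u1 expr1n.
exists f => [j|].
  rewrite /f; case: ifP => _.
    by apply: le_trans (cnormB _ _) _; rewrite cX cnorm1; lra.
  apply: le_trans (cnormB _ _) _; rewrite cX.
  have := cnormB (2 * u ^+ L) 1; rewrite cnormM cX cnorm1.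
  have -> : cnorm (2 : R[i]) = 2.
    by have := cnormR (2 : R); rewrite rmorph_nat ger0_norm.
  lra.
rewrite !mulr_suml -sumrB; apply: eq_bigr => j _.
have jL := ltn_ord j.
have E : \sum_(i < j) (tri L i)%:R * u ^+ i =
    (tri_prev L j)%:R * u ^+ j / (u - 1) - f j / (u - 1) ^+ 2.
  have S : (u - 1) ^+ 2 * (\sum_(i < j) (tri L i)%:R * u ^+ i) =
      (u - 1) * ((tri_prev L j)%:R * u ^+ j) - f j.
    rewrite /f; case: leqP => jl.
      by rewrite tri_partial_up // (_ : tri_prev L j = j) // /tri_prev; lia.
    have -> : (j : nat) = (L + (j - L))%N by lia.
    rewrite tri_partial_down; last by lia.
    by rewrite (_ : tri_prev L _ = (L - (j - L))%N) // /tri_prev; lia.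
  by apply: (mulfI (expf_neq0 2 ne)); rewrite S; field.
have uu := unitJ j u1.
rewrite E mulrBr; congr (_ - _); last by rewrite mulrA.
by rewrite -[RHS]mulr1 -uu; ring.
Qed.

Lemma Im_invc u : complex.Im (u^-1) = - complex.Im u / cnorm u ^+ 2.
Proof. by rewrite cnorm_sqr mulNr; case: u. Qed.

(** The main term is governed by the imaginary part of [(u - 1)^-1]. The remainder is at most 4
    times the sum [L ^+ 2] of the coefficients, divided by [cnorm (u - 1) ^+ 2]. *)
Lemma sum_tri_phase_lower L u : (2 <= L)%N -> cnorm u = 1 -> u != 1 ->
  0 <= complex.Im u ->
  (L%:R ^+ 3 / 4 * complex.Im u - 4 * L%:R ^+ 2) / cnorm (u - 1) ^+ 2 <=
  - \sum_(j < L + L) complex.Im (((tri L j)%:R * conjc (u ^+ j)) *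
     (\sum_(i < j) (tri L i)%:R * u ^+ i)).
Proof.
move=> L2 u1 une Iu; have [f f4 E] := sum_tri_phase L u1 une.
have ne : 0 < cnorm (u - 1) ^+ 2 by rewrite exprn_gt0 // cnorm_gt0 subr_eq0.
rewrite -Im_sum E ImD ImN.
have -> : \sum_(j < L + L) (tri L j)%:R * (tri_prev L j)%:R =
    (\sum_(j < L + L) (tri L j)%:R * (tri_prev L j)%:R : R)%:C.
  rewrite rmorph_sum; apply: eq_bigr => j _.
  by rewrite rmorphM !rmorph_nat.
have G := sum_tri_prev L2.
set g := \sum_(j < L + L) _ in G *.
have -> : complex.Im (g%:C / (u - 1)) = - g * (complex.Im u / cnorm (u - 1) ^+ 2).
  by rewrite ImM Im_invc ImD ImN /= mul0r addr0 subr0; ring.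
set h := complex.Im (_ / _).
have h4 : `|h| <= 4 * L%:R ^+ 2 / cnorm (u - 1) ^+ 2.
  apply: le_trans (ler_Im_cnorm _) _; rewrite cnormM cnormV cnormX.
  rewrite ler_pM2r ?invr_gt0 //; apply: le_trans (cnorm_sum _ _ _) _.
  rewrite -sum_tri mulr_sumr; apply: ler_sum => j _.
  rewrite !cnormM cnormJ cnormX u1 expr1n mulr1 mulrC.
  have -> : cnorm ((tri L j)%:R : R[i]) = (tri L j)%:R.
    by have := cnormR ((tri L j)%:R : R); rewrite rmorph_nat ger0_norm.
  by rewrite ler_wpM2r.
have i0 : 0 <= complex.Im u / cnorm (u - 1) ^+ 2 by rewrite divr_ge0 // ltW.
have := ler_wpM2r i0 G; have := ler_norm (- h); rewrite normrN.
set I := complex.Im u in i0 *; set n := cnorm _ ^+ 2 in h4 i0 *.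
have -> : (L%:R ^+ 3 / 4 * I - 4 * L%:R ^+ 2) / n =
    L%:R ^+ 3 / 4 * (I / n) - 4 * L%:R ^+ 2 / n by ring.
lra.
Qed.

Lemma sin_bounds y : 0 <= y <= 1 -> y / 2 <= sin y <= y.
Proof.
move=> /andP[y0 y1].
have le_sin (z : R) : 0 <= z -> sin z <= z.
  rewrite le_eqVlt => /predU1P[<-|z0]; first by rewrite sin0.
  have [c _ E] := MVT z0 (fun c _ => is_derive_sin c)
    (continuous_subspaceT (@continuous_sin R)).
  rewrite sin0 !subr0 in E; rewrite E; have := cos_le1 c; nra.
have sin_ge0 (z : R) : 0 <= z <= 1 -> 0 <= sin z.
  move=> /andP[z0 z1]; apply: sin_ge0_pi; rewrite z0 /=.
  by have := @pi_ge2 R; lra.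
rewrite le_sin // andbT; move: y0; rewrite le_eqVlt => /predU1P[<-|y0].
  by rewrite sin0; lra.
have [c /andP[c0 cy] E] := MVT y0 (fun c _ => is_derive_sin c)
  (continuous_subspaceT (@continuous_sin R)).
rewrite sin0 !subr0 in E; rewrite E.
(* From [cos c = 1 - 2 * sin (c / 2) ^+ 2] and [sin (c / 2) <= c / 2]. *)
have c1 : 2^-1 <= cos c.
  have -> : c = (c / 2) *+ 2 by rewrite -mulr_natr divfK.
  rewrite !bnd_simp /= in c0 cy.
  rewrite cos_mulr2n cos2sin2; have := le_sin (c / 2); have := sin_ge0 (c / 2).
  move=> h1 h2; have {}h2 : sin (c / 2) <= c / 2 by apply: h2; lra.
  have {}h1 : 0 <= sin (c / 2) by apply: h1; lra.
  nra.
nra.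
Qed.

(** With [y = 2 * pi * t], the bounds 2 and 4 for [pi] place [y] between [4 * t] and [8 * t], hence
    below 1. The rest follows from [cnorm (u - 1) = 2 * sin (y / 2)] and the bounds on the sine. *)
Lemma eT_arc t : 0 < t <= 8^-1 ->
  let u : R[i] := eT t in
  [/\ u != 1, 2 * t <= complex.Im u, cnorm (u - 1) ^+ 2 <= 64 * t ^+ 2,
      (complex.Im u) ^+ 2 <= cnorm (u - 1) ^+ 2 &
      cnorm (u - 1) ^+ 2 <= 8 * t * (2 * complex.Im u)].
Proof.
move=> /andP[t0 t8] u.
have p2 := @pi_ge2 R; have p4 : pi <= 4 :> R by have := @pihalf_lt2 R; lra.
pose y : R := 2 * pi * t.
have y0 : 0 <= y by rewrite /y; nra.
have y4 : 4 * t <= y by rewrite /y; nra.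
have y8 : y <= 8 * t by rewrite /y; nra.
have y1 : y <= 1 by lra.
have /andP[s1 s2] : y / 2 <= sin y <= y by apply: sin_bounds; rewrite y0.
have nE : cnorm (u - 1) ^+ 2 = 2 - 2 * cos y.
  rewrite cnorm_sqr ReD ImD ReN ImN /= oppr0 addr0 -/y.
  by have := cos2Dsin2 y; lra.
have n4 : cnorm (u - 1) ^+ 2 = 4 * sin (y / 2) ^+ 2.
  rewrite nE {1}(_ : y = (y / 2) *+ 2); last by rewrite -mulr_natr divfK.
  by rewrite cos_mulr2n cos2sin2; ring.
have /andP[r1 r2] : y / 2 / 2 <= sin (y / 2) <= y / 2.
  by apply: sin_bounds; apply/andP; split; lra.
have Iu : complex.Im u = sin y by [].
have ny : cnorm (u - 1) ^+ 2 <= y ^+ 2 by rewrite n4; nra.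
split.
- by apply: eT_neq1; rewrite t0 /=; lra.
- by rewrite Iu; lra.
- by apply: le_trans ny _; nra.
- rewrite nE Iu; have := cos2Dsin2 y; have := cos_le1 y; nra.
- by apply: le_trans ny _; rewrite Iu; nra.
Qed.

(** Here [t] is the distance to the resonance, measured in steps [i] of length [1 / (L + L)]. The
    main term is at least [L / (64 * t)], which gives a harmonic term in [i]; the remainder is at
    most [1 / t^2], which gives a summable one. *)
Lemma tri_phase_arc L t i : (2 <= L)%N -> (0 < i)%N ->
  i%:R / (L + L)%:R <= t <= i.+1%:R / (L + L)%:R -> t <= 8^-1 ->
  (L + L)%:R ^+ 2 * ((128 * i.+1%:R)^-1 - (i%:R ^+ 2)^-1) <=
  - L%:R ^- 2 * \sum_(j < L + L) complex.Im (((tri L j)%:R * conjc (eT t ^+ j)) *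
     (\sum_(i < j) (tri L i)%:R * eT t ^+ i)).
Proof.
move=> L2 i0 /andP[ti ti1] t8.
have l0 : 0 < L%:R :> R by rewrite ltr0n; lia.
have I0 : 0 < i%:R :> R by rewrite ltr0n.
have I1 : 0 < i.+1%:R :> R by rewrite ltr0n.
rewrite natrD in ti ti1 *.
have t0 : 0 < t by apply: lt_le_trans ti; rewrite divr_gt0 // addr_gt0.
rewrite ler_pdivrMr ?addr_gt0 // in ti; rewrite ler_pdivlMr ?addr_gt0 // in ti1.
have t08 : 0 < t <= 8^-1 by rewrite t0.
have [u1 Iu nu nI nI2] := eT_arc t08.
set u := eT t in u1 Iu nu nI nI2 *.
have Iu0 : 0 <= complex.Im u by apply: le_trans Iu; nra.
have H := sum_tri_phase_lower L2 (cnorm_eT t) u1 Iu0.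
have n0 : 0 < cnorm (u - 1) ^+ 2 by rewrite exprn_gt0 // cnorm_gt0 subr_eq0.
rewrite mulNr -mulrN; apply: le_trans (ler_wpM2l _ H); last first.
  by rewrite invr_ge0 sqr_ge0.
set n := cnorm (u - 1) ^+ 2 in n0 nu nI nI2 *; set I := complex.Im u in Iu nI nI2 Iu0 *.
have -> : L%:R ^- 2 * ((L%:R ^+ 3 / 4 * I - 4 * L%:R ^+ 2) / n) =
    L%:R / 4 * (I / n) - 4 / n.
  by field; rewrite !gt_eqF.
have b1 : (16 * t)^-1 <= I / n.
  rewrite ler_pdivlMr // mulrC ler_pdivrMr; last by lra.
  by lra.
have b2 : 4 / n <= (t ^+ 2)^-1.
  rewrite ler_pdivrMr // mulrC ler_pdivlMr ?exprn_gt0 //; nra.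
have c1 : (L%:R + L%:R) ^+ 2 * (128 * i.+1%:R)^-1 <= L%:R / 4 * (16 * t)^-1.
  rewrite (_ : L%:R / 4 * _ = L%:R / (64 * t)); last by field; rewrite gt_eqF.
  rewrite ler_pdivrMr; last by lra.
  rewrite mulrAC ler_pdivlMr; last by lra.
  by have := ler_wpM2l (ltW l0) ti1; lra.
have c2 : (t ^+ 2)^-1 <= (L%:R + L%:R) ^+ 2 * (i%:R ^+ 2)^-1.
  rewrite ler_pdivlMr ?exprn_gt0 // mulrC ler_pdivrMr ?exprn_gt0 //.
  by rewrite -exprMn ler_pXn2r ?nnegrE ?mulr_ge0 ?addr_ge0 //; lra.
have l4 : 0 <= L%:R / 4 :> R by lra.
rewrite mulrBr; apply: lerB; first exact: le_trans c1 (ler_wpM2l l4 b1).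
exact: le_trans b2 c2.
Qed.

End BlockPhase.

Lemma block_index_lt k m K n : (k < n)%N -> (m < K)%N -> (k * K + m < n * K)%N.
Proof.
move=> kn mK; apply: leq_trans (leq_mul kn (leqnn K)).
by rewrite mulSn addnC ltn_add2r.
Qed.

(** * Inverse squares and the harmonic series *)

Section ElementarySums.
Variable R : realType.

Lemma sum_rev_nat (f : nat -> R) J p : (p <= J)%N ->
  \sum_(J - p <= k < J) f (J - k)%N = \sum_(i < p) f i.+1.
Proof.
elim: p => [|p IHp] pJ; first by rewrite subn0 big_geq // big_ord0.
rewrite big_ltn; last by lia.
have -> : ((J - p.+1).+1 = J - p)%N by lia.
rewrite IHp ?(ltnW pJ) // [RHS]big_ord_recr /= [RHS]addrC; congr (f _ + _); lia.
Qed.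

(** The stronger bound [2 - 1 / p] for [p] terms is the one that passes through induction. *)
Lemma sum_inv_sqr_le2 p : \sum_(i < p) (i.+1%:R ^+ 2)^-1 <= 2 :> R.
Proof.
suff H : \sum_(i < p.+1) (i.+1%:R ^+ 2)^-1 <= 2 - p.+1%:R^-1 :> R.
  apply: le_trans (le_trans H _); last by rewrite lerBlDr lerDl invr_ge0.
  by rewrite big_ord_recr /= lerDl invr_ge0 sqr_ge0.
elim: p => [|p IHp]; first by rewrite big_ord1 /= expr1n invr1; lra.
rewrite big_ord_recr /=; apply: le_trans (lerD IHp (lexx _)) _.
rewrite -[p.+2%:R]natr1; set n := p.+1%:R : R.
have n0 : 0 < n by rewrite ltr0n.
rewrite -subr_ge0.
rewrite (_ : _ - _ = (n * (n + 1) ^+ 2)^-1); last first.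
  by field; rewrite !gt_eqF // addr_gt0.
by rewrite invr_ge0 mulr_ge0 ?sqr_ge0 // ltW.
Qed.

(** Doubling the number [p] of terms adds [p] terms that are each at least [1 / (3 * p)]. *)
Lemma harmonic_unbounded (M : R) :
  exists2 p : nat, (0 < p)%N & M <= \sum_(i < p) (i.+2%:R)^-1.
Proof.
suff H n : exists2 p : nat, (0 < p)%N & n%:R / 3 <= \sum_(i < p) (i.+2%:R)^-1 :> R.
  have [p p0 hp] := H (Num.truncn (3 * `|M|)).+1; exists p => //.
  apply: le_trans hp; rewrite ler_pdivlMr //.
  have := truncnS_gt (3 * `|M|); have := ler_norm M; lra.
elim: n => [|n [p p0 hp]].
  by exists 1%N => //; rewrite big_ord1 mul0r invr_ge0.
exists (p + p)%N; first by lia.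
rewrite big_split_ord /= -natr1 mulrDl; apply: lerD => //.
apply: (@le_trans _ _ (\sum_(i < p) (3 * p%:R)^-1)).
  rewrite sumr_const card_ord -mulr_natr.
  have P0 : 0 < p%:R :> R by rewrite ltr0n.
  by rewrite -subr_ge0 (_ : _ - _ = 0) //; field; rewrite gt_eqF.
apply: ler_sum => i _; rewrite lef_pV2 ?posrE ?ltr0n //.
  by rewrite -natrM ler_nat; have := ltn_ord i; lia.
by rewrite mulr_gt0 // ltr0n.
Qed.

End ElementarySums.

(** * A stage: blocks tuned in turn to all frequencies [k / (L + L)] *)

Section Stage.
Variable R : realType.
Implicit Types (x e : R) (L m k : nat) (C : R[i]).

(** The path [A] of a block with coefficients of unit size, at offset [x] from the resonance;
    dividing by [L] makes the peak coefficient 1. The two definitions that follow are its energy [B]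
    and its phase [tau] in the sense of [block_step]. *)
Definition tri_poly L x m : R[i] :=
  \sum_(j < m) ((tri L j)%:R / L%:R)%:C * eT x ^+ j.

Definition tri_energy L x : R :=
  \sum_(j < L + L) cnorm (tri_poly L x j.+1) ^+ 2.

Definition tri_phase L x : R :=
  \sum_(j < L + L) complex.Im
    (conjc (((tri L j)%:R / L%:R)%:C * eT x ^+ j) * tri_poly L x j).

Lemma tri_coef_le1 L j : 0 <= ((tri L j)%:R / L%:R : R) <= 1.
Proof.
have [->|L0] := posnP L; first by rewrite invr0 mulr0 lexx ler01.
rewrite divr_ge0 //= ler_pdivrMr ?ltr0n // mul1r ler_nat; exact: tri_le.
Qed.

(** Parseval bounds the sum over [k] of each squared truncation by [(L + L)^2], and there are
    [L + L] truncations. *)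
Lemma tri_energy_sum L x : (0 < L)%N ->
  \sum_(k < L + L) tri_energy L (x - k%:R / (L + L)%:R) <= (L + L)%:R ^+ 3.
Proof.
move=> L0; rewrite /tri_energy exchange_big /=.
apply: (@le_trans _ _ (\sum_(j < L + L) (L + L)%:R ^+ 2)); last first.
  by rewrite sumr_const card_ord -[_ ^+ 2 *+ _]mulr_natr -exprSr.
apply: ler_sum => j _; rewrite /tri_poly.
rewrite (parseval_roots x (fun m => (tri L m)%:R / L%:R)) // expr2 ler_wpM2l //.
apply: (@le_trans _ _ (\sum_(i < j.+1) 1)); last first.
  by rewrite sumr_const card_ord ler_nat.
apply: ler_sum => i _; have /andP[t0 t1] := tri_coef_le1 L i.
by rewrite expr_le1.
Qed.

(** The completed path is the square of a geometric sum, divided by [L], so that Parseval applies to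
    its modulus itself. This gain is the purpose of the triangular profile. *)
Lemma tri_end_sum L x : (0 < L)%N ->
  \sum_(k < L + L) cnorm (tri_poly L (x - k%:R / (L + L)%:R) (L + L)) = (L + L)%:R.
Proof.
move=> L0; have l0 : L%:R != 0 :> R by rewrite pnatr_eq0 -lt0n.
have E y : cnorm (tri_poly L y (L + L)) =
    L%:R^-1 * cnorm (\sum_(m < L) (1 : R)%:C * eT y ^+ m) ^+ 2.
  have -> : tri_poly L y (L + L) = (L%:R^-1)%:C * (\sum_(m < L) (1 : R)%:C * eT y ^+ m) ^+ 2.
    under [in RHS]eq_bigr do rewrite mul1r.
    rewrite -tri_sum mulr_sumr; apply: eq_bigr => j _.
    by rewrite mulrC rmorphM /= rmorph_nat; ring.
  by rewrite cnormM cnormX cnormR ger0_norm // invr_ge0.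
under eq_bigr do rewrite E.
rewrite -mulr_sumr (parseval_roots x (fun=> 1)) ?leq_addr //.
under eq_bigr do rewrite expr1n.
by rewrite sumr_const card_ord mulrCA mulVf // mulr1.
Qed.

Lemma tri_periodic L x n : (tri_energy L (x + n%:R) = tri_energy L x) *
  (tri_phase L (x + n%:R) = tri_phase L x) *
  (forall m, tri_poly L (x + n%:R) m = tri_poly L x m).
Proof.
by rewrite /tri_energy /tri_phase /tri_poly eTD eT_nat mulr1.
Qed.

Lemma tri_phase_lower L t i : (2 <= L)%N -> (0 < i)%N ->
  i%:R / (L + L)%:R <= t <= i.+1%:R / (L + L)%:R -> t <= 8^-1 ->
  (L + L)%:R ^+ 2 * ((128 * i.+1%:R)^-1 - (i%:R ^+ 2)^-1) <= - tri_phase L t.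
Proof.
move=> L2 i0 ht t8; apply: le_trans (tri_phase_arc L2 i0 ht t8) _.
rewrite mulNr lerN2 le_eqVlt; apply/orP; left; apply/eqP.
rewrite mulr_sumr; apply: eq_bigr => j _.
have -> : tri_poly L t j = (L%:R^-1)%:C * \sum_(i < j) (tri L i)%:R * eT t ^+ i.
  rewrite /tri_poly mulr_sumr; apply: eq_bigr => h _.
  by rewrite mulrC rmorphM /= rmorph_nat; ring.
rewrite conjcM conjc_real rmorphM /= rmorph_nat.
set X := \sum_(_ < _) _; set Y := conjc _.
have -> : (tri L j)%:R * (L%:R^-1)%:C * Y * ((L%:R^-1)%:C * X) =
    (L%:R ^- 2)%:C * ((tri L j)%:R * Y * X).
  by rewrite -exprVn rmorphXn /=; ring.
by rewrite ImM /= mul0r addr0.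
Qed.

(** Index [n] denotes position [n %% (L + L)] in block [n %/ (L + L)]; the last factor tunes that
    block to its frequency. *)
Definition stage_coef L e n : R[i] :=
  (e * ((tri L (n %% (L + L)))%:R / L%:R))%:C *
  eT (- ((n %/ (L + L))%:R / (L + L)%:R)) ^+ (n %% (L + L)).

Lemma cnorm_stage_coef L e n : 0 <= e -> cnorm (stage_coef L e n) <= e.
Proof.
move=> e0; rewrite /stage_coef cnormM cnormX cnorm_eT expr1n mulr1 cnormR.
have /andP[t0 t1] := tri_coef_le1 L (n %% (L + L)).
by rewrite ger0_norm ?mulr_ge0 // ler_piMr.
Qed.

(** The relative error in [block_step] when the coefficients have size [e]: the path scales by [e]
    and its energy by [e ^+ 2]. *)
Definition block_error L e x : R :=
  3 * (e * cnorm (tri_poly L x (L + L))) +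
  2 * e * (e ^+ 2 * tri_energy L x) +
  2 * e ^+ 2 * (L + L)%:R * (e ^+ 2 * tri_energy L x) + (L + L)%:R * e ^+ 2.

Lemma block_error_ge0 L e x : 0 <= e -> 0 <= block_error L e x.
Proof.
move=> e0; have B0 : 0 <= tri_energy L x by apply: sumr_ge0 => j _; exact: sqr_ge0.
have D0 := cnorm_ge0 (tri_poly L x (L + L)).
have e2 := exprn_ge0 2 e0; have K0 : 0 <= (L + L)%:R :> R by [].
have eB := mulr_ge0 e2 B0; have Ke := mulr_ge0 K0 e2.
have eeB := mulr_ge0 e0 eB; have KeB := mulr_ge0 Ke eB; have eD := mulr_ge0 e0 D0.
rewrite /block_error; lra.
Qed.

(** In block [k], the power of [eT x] and the tuning factor combine to [eT y ^+ m] times a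
    unimodular constant common to the block. That constant drops out of all moduli and of the phase,
    so [block_step] applies with data depending on [y] only. *)
Lemma stage_block L e x C (v : nat -> R[i]) k : (0 < L)%N -> 0 <= e ->
  (L + L)%:R * e <= 2^-1 -> cnorm C = 1 ->
  (forall m, (m < L + L)%N ->
    v (k * (L + L) + m).+1 = v (k * (L + L) + m)%N -
      stage_coef L e (k * (L + L) + m) * (C * eT x ^+ (k * (L + L) + m).+1) *
      conjc (v (k * (L + L) + m)%N)) ->
  let y := x - k%:R / (L + L)%:R in
  let tau := e ^+ 2 * tri_phase L y in
  cnorm (v (k.+1 * (L + L))%N - v (k * (L + L))%N * (1 - 'i * tau%:C)) <=
    cnorm (v (k * (L + L))%N) * block_error L e y /\
  tau ^+ 2 <= e ^+ 2 * (L + L)%:R * (e ^+ 2 * tri_energy L y).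
Proof.
move=> L0 e0 Ke C1 vS y tau; set K := (L + L)%N in Ke vS y tau *.
have K0 : (0 < K)%N by rewrite /K; lia.
pose c : R[i] := - (C * eT x ^+ (k * K).+1).
have c1 : cnorm c = 1 by rewrite cnormN cnormM cnormX cnorm_eT expr1n C1 mulr1.
pose a m : R[i] := c * e%:C * (((tri L m)%:R / L%:R)%:C * eT y ^+ m).
pose w m := v (k * K + m)%N.
have wS m : (m < K)%N -> w m.+1 = w m + a m * conjc (w m).
  move=> mK; rewrite /w addnS vS // -[- _]mulNr -/(w m); congr (_ + _ * _).
  rewrite /stage_coef -/K divnMDl // modnMDl (divn_small mK) (modn_small mK) addn0.
  rewrite /a /c /y eTD exprMn -addSn [in LHS]exprD rmorphM /=; ring.
have ae m : (m < K)%N -> cnorm (a m) <= e.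
  move=> _; rewrite /a !cnormM c1 mul1r cnormX cnorm_eT expr1n mulr1 !cnormR.
  have /andP[t0 t1] := tri_coef_le1 L m.
  by rewrite !ger0_norm ?mulr_ge0 // ler_piMr.
have A m : \sum_(j < m) a j = c * e%:C * tri_poly L y m.
  by rewrite /tri_poly mulr_sumr.
have nA m : cnorm (\sum_(j < m) a j) = e * cnorm (tri_poly L y m).
  by rewrite A !cnormM c1 mul1r cnormR ger0_norm.
have := block_step wS ae Ke; cbv zeta.
have -> : \sum_(j < K) cnorm (\sum_(i < j.+1) a i) ^+ 2 = e ^+ 2 * tri_energy L y.
  by rewrite mulr_sumr; apply: eq_bigr => j _; rewrite nA exprMn.
have -> : \sum_(j < K) complex.Im (conjc (a j) * \sum_(i < j) a i) = tau.
  rewrite /tau /tri_phase mulr_sumr; apply: eq_bigr => j _; rewrite A /a.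
  set g := _%:C * eT y ^+ j; set p := tri_poly _ _ _.
  have -> : conjc (c * e%:C * g) * (c * e%:C * p) =
      (e ^+ 2)%:C * (conjc g * p).
    have cc := unitJ 1 c1; rewrite expr1 in cc.
    by rewrite !conjcM conjc_real rmorphXn /= -[RHS]mul1r -cc; ring.
  by rewrite ImM /= mul0r addr0.
by rewrite nA /w addn0 -mulSnr.
Qed.

(** The second turn of frequencies is the first one seen from [x - 1]. *)
Lemma sum_two_turns (f : R -> R) K (x b : R) : (0 < K)%N ->
  (forall y, \sum_(k < K) f (y - k%:R / K%:R) <= b) ->
  \sum_(k < K + K) f (x - k%:R / K%:R) <= b + b.
Proof.
move=> K0 H; rewrite big_split_ord /=; apply: lerD; first exact: H.
have := H (x - 1); apply: le_trans; apply: ler_sum => k _.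
rewrite natrD mulrDl divff ?pnatr_eq0 -?lt0n //.
by rewrite opprD addrA.
Qed.

(** With [l = (L + L) * e], the five contributions are at most [6 l], [4 l^3], [4 l^4], [2 l^2] and
    [2 l^4]; since [l <= 1] they add up to at most [18 l]. *)
Lemma block_error_sum L e x : (0 < L)%N -> 0 <= e -> (L + L)%:R * e <= 1 ->
  \sum_(k < (L + L) + (L + L))
    (block_error L e (x - k%:R / (L + L)%:R) +
     e ^+ 2 * (L + L)%:R * (e ^+ 2 * tri_energy L (x - k%:R / (L + L)%:R)))
  <= 18 * ((L + L)%:R * e).
Proof.
move=> L0 e0 l1; set K := (L + L)%N in l1 *.
have K0 : (0 < K)%N by rewrite /K; lia.
have hD : \sum_(k < K + K) cnorm (tri_poly L (x - k%:R / K%:R) K) <= K%:R + K%:R.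
  apply: (@sum_two_turns (fun y => cnorm (tri_poly L y K))) => // y.
  by rewrite tri_end_sum.
have hB := @sum_two_turns (tri_energy L) K x (K%:R ^+ 3) K0
  (fun y => tri_energy_sum y L0).
rewrite -/K in hD hB.
rewrite /block_error -/K !big_split /= -!mulr_sumr sumr_const card_ord.
set D := \sum_(k < K + K) _ in hD *; set B := \sum_(k < K + K) _ in hB *.
rewrite -[e *+ _]mulr_natr natrD.
have Ke0 : 0 <= K%:R * e by rewrite mulr_ge0.
set l := K%:R * e in l1 Ke0 *.
have d : e * D <= 2 * l by have := ler_wpM2l e0 hD; rewrite /l; lra.
have b3 : e * (e ^+ 2 * B) <= 2 * l ^+ 3.
  have := ler_wpM2l (exprn_ge0 3 e0) hB; rewrite /l; lra.
have b4 : e ^+ 2 * K%:R * (e ^+ 2 * B) <= 2 * l ^+ 4.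
  have := ler_wpM2l (mulr_ge0 (exprn_ge0 4 e0) (ler0n R K)) hB; rewrite /l; lra.
have l2 : l ^+ 2 <= l by nra.
have l3 : l ^+ 3 <= l by have := exprn_ge0 2 Ke0; nra.
have l4 : l ^+ 4 <= l by have := exprn_ge0 3 Ke0; nra.
have -> : K%:R * (e * (e * (K%:R + K%:R))) = 2 * l ^+ 2 by rewrite /l; ring.
lra.
Qed.

(* [C] stands for the power of [eT x] accumulated before the stage. *)
Definition stage_spec (d : R) (n : nat) (l : nat -> R[i]) : Prop :=
  [/\ (0 < n)%N, (forall i, cnorm (l i) <= 2^-1),
      \sum_(i < n) cnorm (l i) ^+ 2 <= d &
      forall x C (v : nat -> R[i]), 0 <= x < 1 -> cnorm C = 1 -> v 0%N != 0 ->
      (forall i, (i < n)%N -> v i.+1 = v i -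
         l i * (C * eT x ^+ i.+1) * conjc (v i)) ->
      [/\ (1 - d) * cnorm (v 0%N) <= cnorm (v n),
          cnorm (v n) <= (1 + d) * cnorm (v 0%N) &
          exists i1 i2, [/\ (i1 <= n)%N, (i2 <= n)%N &
            cnorm (v 0%N) / 10 <= cnorm (v i2 - v i1)]]].

(* Block [k] of the stage is tuned to the frequency [k / (L + L)].  Before the
   resonance at [x], the phases [- tau k] are comparable to the terms of a
   harmonic series, while all the other effects of the blocks are summable. *)
Lemma stage_exists (d : R) : 0 < d ->
  exists n l, stage_spec d n l.
Proof.
(* The total error will be [18 * la]. The bound [d / 36] makes twice this at most [d], as the
   modulus estimates require; the bound 1/400 makes it at most 1/20, as the motion estimate
   requires. *)
move=> d0; pose la : R := Num.min (d / 36) (400^-1).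
have la0 : 0 < la by rewrite lt_min; apply/andP; split; lra.
have lad : 36 * la <= d.
  by have : la <= d / 36 by [rewrite ge_min lexx]; lra.
have la4 : la <= 400^-1 by rewrite ge_min lexx orbT.
(* After division by 128 and loss of at most 2 to the inverse squares, the harmonic sum still
   exceeds [la ^- 2], so the rotations will total at least 1. *)
have [p p0 hp] := harmonic_unbounded (128 * (la ^- 2 + 2)).
(* Then [q / K = 1 / 8], so the [p] blocks before the resonance lie on the arc where the phase
   estimate holds. *)
pose q := p.+1; pose L := (4 * q)%N.
have L2 : (2 <= L)%N by rewrite /L /q; lia.
have L0 : (0 < L)%N by lia.
set K := (L + L)%N; have K8 : K = (8 * q)%N by rewrite /K /L; lia.
have K0 : (0 < K)%N by lia.
have k0 : 0 < K%:R :> R by rewrite ltr0n.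
pose e := la / K%:R.
have e0 : 0 <= e by rewrite divr_ge0 // ltW.
have Ke : K%:R * e = la by rewrite /e mulrC divfK // gt_eqF.
have ele : e <= la.
  by rewrite /e ler_pdivrMr // ler_peMr ?ler1n // ltW.
exists ((K + K) * K)%N, (stage_coef L e); split.
- by rewrite muln_gt0 addn_gt0 K0.
- by move=> i; apply: le_trans (cnorm_stage_coef _ _ e0) _; lra.
- apply: (@le_trans _ _ (\sum_(i < (K + K) * K) e ^+ 2)).
    apply: ler_sum => i _; rewrite ler_pXn2r ?nnegrE ?cnorm_ge0 //.
    exact: cnorm_stage_coef.
  rewrite sumr_const card_ord -[_ ^+ 2 *+ _]mulr_natr natrM natrD.
  have -> : e ^+ 2 * ((K%:R + K%:R) * K%:R) = 2 * (K%:R * e) ^+ 2 by ring.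
  rewrite Ke.
  nra.
move=> x C v /andP[x0 x1] C1 v0 vS.
pose y k := x - k%:R / K%:R; pose V k := v (k * K)%N.
pose tau k := e ^+ 2 * tri_phase L (y k).
have step k : (k < K + K)%N ->
  cnorm (V k.+1 - V k * (1 - 'i * (tau k)%:C)) <= cnorm (V k) * block_error L e (y k) /\
  tau k ^+ 2 <= e ^+ 2 * K%:R * (e ^+ 2 * tri_energy L (y k)).
  move=> kK; apply: stage_block C1 _ => //; first by rewrite -/K Ke; lra.
  by move=> m mK; apply: vS; exact: block_index_lt.
have E0 k : (k < K + K)%N -> 0 <= block_error L e (y k).
  by move=> _; exact: block_error_ge0.
have VE k (hk : (k < K + K)%N) := (step k hk).1.
have F18 : \sum_(k < K + K) (block_error L e (y k) + tau k ^+ 2) <= 18 * la.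
  rewrite -Ke; apply: le_trans (block_error_sum x L0 e0 _); last by rewrite -/K Ke; lra.
  by apply: ler_sum => k _; rewrite lerD2l (step k (ltn_ord k)).2.
have F4 : \sum_(k < K + K) (block_error L e (y k) + tau k ^+ 2) <= 4^-1 by lra.
have F20 : \sum_(k < K + K) (block_error L e (y k) + tau k ^+ 2) <= 20^-1 by lra.
have [m1 m2] := near_rotations_modulus E0 VE F4 (leqnn _).
have V0 : V 0%N = v 0%N by rewrite /V mul0n.
rewrite V0 in m1 m2; have nv0 := cnorm_ge0 (v 0%N).
split.
- by apply: le_trans m1; rewrite ler_wpM2r //; lra.
- by apply: le_trans m2 _; rewrite ler_wpM2r //; lra.
pose M := Num.truncn (K%:R * x).
have /andP[M1 M2] : M%:R <= K%:R * x < M.+1%:R.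
  by apply: truncn_itv; rewrite mulr_ge0 // ltW.
have MK : (M < K)%N.
  by rewrite -(ltr_nat R); apply: le_lt_trans M1 _; rewrite gtr_pMr.
(* The resonance is taken in the second turn of frequencies, so that at least [p] blocks precede it
   wherever [x] lies. *)
pose J := (M + K)%N.
(* A bound for the positive part of the phase at distance [i] from the resonance. *)
pose dd (i : nat) : R := la ^+ 2 * (i%:R ^+ 2)^-1.
have pJ : (p <= J)%N.
  by apply: leq_trans (leq_addl _ _); rewrite K8 /q; clear; lia.
have low k : (J - p <= k < J)%N ->
    la ^+ 2 * ((128 * (J - k).+1%:R)^-1 - ((J - k)%:R ^+ 2)^-1) <= - tau k.
  move=> hk; pose i := (J - k)%N.
  pose t : R := (K%:R * x - M%:R + i%:R) / K%:R.
  have yt : y k + 1 = t.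
    have Jk : M%:R + K%:R = k%:R + i%:R :> R.
      by rewrite -!natrD; congr (_%:R); rewrite /i subnKC //; case/andP: hk => _ /ltnW.
    have kE : k%:R = M%:R + K%:R - i%:R :> R by rewrite Jk addrK.
    by rewrite /y /t kE; field; rewrite gt_eqF.
  have i0 : (0 < i)%N by rewrite subn_gt0; case/andP: hk.
  have iq : (i < q)%N by rewrite ltnS leq_subLR addnC -leq_subLR; case/andP: hk.
  have t1 : i%:R / K%:R <= t <= i.+1%:R / K%:R.
    have M3 : K%:R * x < M%:R + 1 by rewrite natr1.
    by rewrite /t !ler_pM2r ?invr_gt0 // -[i.+1%:R]natr1; apply/andP; split; lra.
  have t8 : t <= 8^-1.
    have /andP[_] := t1; move/le_trans; apply.
    by rewrite ler_pdivrMr // mulrC ler_pdivlMr // -natrM ler_nat K8 mulnC leq_mul2l.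
  have := tri_phase_lower L2 i0 t1 t8; rewrite -/K => /(ler_wpM2l (sqr_ge0 e)).
  rewrite mulrA -exprMn [e * _]mulrC Ke => /le_trans; apply.
  by rewrite mulrN /tau -yt (tri_periodic L (y k) 1).1.2.
have J12 : (J - p <= J <= K + K)%N by rewrite leq_subr leq_add2r ltnW.
have dk k : (J - p <= k < J)%N -> 0 <= dd (J - k)%N /\ tau k <= dd (J - k)%N.
  move=> hk; split; first by rewrite mulr_ge0 ?invr_ge0 ?sqr_ge0.
  rewrite -lerN2; apply: le_trans (low k hk); rewrite mulrBr lerBrDr addNr.
  by rewrite mulr_ge0 ?sqr_ge0 // invr_ge0 mulr_ge0.
have sd : \sum_(J - p <= k < J) dd (J - k)%N <= 20^-1.
  rewrite (sum_rev_nat dd pJ) /dd -mulr_sumr.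
  have := sum_inv_sqr_le2 R p; set s := \sum_(i < p) _ => s2.
  have : la ^+ 2 * s <= la ^+ 2 * 2 by rewrite ler_wpM2l ?sqr_ge0.
  by nra.
have st : 1 <= \sum_(J - p <= k < J) - tau k.
  apply: (@le_trans _ _ (\sum_(J - p <= k < J)
      la ^+ 2 * ((128 * (J - k).+1%:R)^-1 - ((J - k)%:R ^+ 2)^-1))); last first.
    by rewrite !big_nat; apply: ler_sum => k hk; exact: low.
  rewrite (sum_rev_nat (fun i => la ^+ 2 * ((128 * i.+1%:R)^-1 - (i%:R ^+ 2)^-1)) pJ).
  rewrite -mulr_sumr sumrB.
  under eq_bigr do rewrite invfM.
  rewrite -mulr_sumr; have := sum_inv_sqr_le2 R p.
  set s := \sum_(i < p) (_ ^+ 2)^-1; set h := \sum_(i < p) _ in hp * => s2.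
  have l2 : 0 < la ^+ 2 by rewrite exprn_gt0.
  rewrite -[X in X <= _](mulfV (lt0r_neq0 l2)) ler_wpM2l ?sqr_ge0 //; lra.
have nz : cnorm (V 0%N) != 0 by rewrite V0 cnorm_eq0.
have [k kJ mv] := near_rotations_move E0 VE F20 J12 dk sd st nz.
exists ((J - p) * K)%N, (k * K)%N; split; last by rewrite -V0.
  by case/andP: J12 => h1 h2; rewrite leq_mul2r (leq_trans h1 h2) orbT.
by case/andP: J12 => _ h2; case/andP: kJ => _ h3; rewrite leq_mul2r (leq_trans h3 h2) orbT.
Qed.

End Stage.

(** * Means over the circle and uniform limits of polynomials *)

Section CircleMean.
Variable R : realType.
Notation mu := (@lebesgue_measure R).
Implicit Types (f g : R -> R[i]) (p q : {poly R[i]}).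

Definition bounded_measurable f : Prop :=
  [/\ measurable_fun setT (fun x => complex.Re (f x)),
      measurable_fun setT (fun x => complex.Im (f x)) &
      exists M, forall x, cnorm (f x) <= M].

Lemma bm_cst c : bounded_measurable (fun=> c).
Proof. by split=> //; exists (cnorm c). Qed.

Lemma bmD f g : bounded_measurable f -> bounded_measurable g ->
  bounded_measurable (fun x => f x + g x).
Proof.
move=> [f1 f2 [M fM]] [g1 g2 [N gN]]; split.
- under eq_fun do rewrite ReD; exact: measurable_funD.
- under eq_fun do rewrite ImD; exact: measurable_funD.
- by exists (M + N) => x; apply: le_trans (cnormD _ _) (lerD _ _).
Qed.

Lemma bmM f g : bounded_measurable f -> bounded_measurable g ->
  bounded_measurable (fun x => f x * g x).
Proof.
move=> [f1 f2 [M fM]] [g1 g2 [N gN]]; split.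
- under eq_fun do rewrite ReM.
  by apply: measurable_funB; exact: measurable_funM.
- under eq_fun do rewrite ImM.
  by apply: measurable_funD; exact: measurable_funM.
- by exists (M * N) => x; rewrite cnormM ler_pM ?cnorm_ge0.
Qed.

Lemma bmJ f : bounded_measurable f -> bounded_measurable (fun x => conjc (f x)).
Proof.
move=> [f1 f2 [M fM]]; split.
- by under eq_fun do rewrite ReJ.
- under eq_fun do rewrite ImJ; exact: measurable_funN.
- by exists M => x; rewrite cnormJ.
Qed.

Lemma bm_real (h : R -> R) M : measurable_fun setT h ->
  (forall x, `|h x| <= M) -> bounded_measurable (fun x => (h x)%:C).
Proof.
move=> mh hM; split; [exact: mh|exact: measurable_cst|].
by exists M => x; rewrite cnormR.
Qed.

Lemma continuous_cos2pi : continuous (fun x : R => cos (2 * pi * x)).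
Proof.
move=> x; apply: continuous_comp; last exact: continuous_cos.
by apply: continuousM; [exact: cvg_cst|exact: cvg_id].
Qed.

Lemma continuous_sin2pi : continuous (fun x : R => sin (2 * pi * x)).
Proof.
move=> x; apply: continuous_comp; last exact: continuous_sin.
by apply: continuousM; [exact: cvg_cst|exact: cvg_id].
Qed.

Lemma bm_eT : bounded_measurable (@eT R).
Proof.
split; [exact: continuous_measurable_fun continuous_cos2pi
       |exact: continuous_measurable_fun continuous_sin2pi|].
by exists 1 => x; rewrite cnorm_eT.
Qed.

Lemma bm_horner p : bounded_measurable (fun x => p.[eT x]).
Proof.
elim/poly_ind: p => [|p c IHp].
  by under eq_fun do rewrite horner0; exact: bm_cst.
under eq_fun do rewrite hornerMXaddC.
by apply: bmD; [apply: bmM => //; exact: bm_eT|exact: bm_cst].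
Qed.

Lemma measurable_I01 : @measurable _ (measurableTypeR R) (@I01 R).
Proof. exact: measurable_itv. Qed.

Lemma lebesgue_I01 : mu (@I01 R) = 1%E.
Proof. by rewrite /I01 lebesgue_measure_itv /= lte_fin ltr01 oppr0 adde0. Qed.

Lemma bounded_integrable (h : R -> R) M : measurable_fun setT h ->
  (forall x, `|h x| <= M) -> mu.-integrable (@I01 R) (EFin \o h).
Proof.
move=> mh hM; apply: measurable_bounded_integrable.
- exact: measurable_I01.
- by apply: (@le_lt_trans _ _ 1%E); rewrite ?ltry // -lebesgue_I01.
- exact: measurable_funTS.
- exists M; split; first exact: num_real.
  by move=> y My x _ /=; apply: le_trans (hM x) (ltW My).
Qed.

Lemma bm_integrable f : bounded_measurable f ->
  mu.-integrable (@I01 R) (EFin \o (fun x => complex.Re (f x))) /\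
  mu.-integrable (@I01 R) (EFin \o (fun x => complex.Im (f x))).
Proof.
move=> [f1 f2 [M fM]]; split; apply: (@bounded_integrable _ M) => // x.
  exact: le_trans (ler_Re_cnorm _) (fM x).
exact: le_trans (ler_Im_cnorm _) (fM x).
Qed.

(* [cint] at Lebesgue measure, which lives on a copy of [R] that carries a
   different measurability display. *)
Definition mean f : R[i] :=
  Complex (Rintegral mu (@I01 R) (fun x => complex.Re (f x)))
          (Rintegral mu (@I01 R) (fun x => complex.Im (f x))).

Lemma eq_mean f g : f =1 g -> mean f = mean g.
Proof. by move=> fg; congr mean; apply/funext. Qed.

Lemma meanD f g : bounded_measurable f -> bounded_measurable g ->
  mean (fun x => f x + g x) = mean f + mean g.
Proof.
move=> /bm_integrable[f1 f2] /bm_integrable[g1 g2].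
have mI := measurable_I01; rewrite /mean.
apply: complex_eq; rewrite /= -RintegralD //; apply: eq_Rintegral => x _ /=.
  by rewrite ReD.
by rewrite ImD.
Qed.

Lemma meanZ c f : bounded_measurable f ->
  mean (fun x => c * f x) = c * mean f.
Proof.
move=> /bm_integrable[f1 f2]; have mI := measurable_I01.
have Z (a : R) (h : R -> R) : mu.-integrable (@I01 R) (EFin \o h) ->
    mu.-integrable (@I01 R) (EFin \o (fun x => a * h x)).
  by move=> hi; exact: (integrableZl mI a hi).
apply: complex_eq; rewrite ?ReM ?ImM /=.
  rewrite -!RintegralZl // -RintegralB; [|exact: mI|exact: Z|exact: Z].
  by apply: eq_Rintegral => x _; rewrite ReM.
rewrite -!RintegralZl // -RintegralD; [|exact: mI|exact: Z|exact: Z].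
by apply: eq_Rintegral => x _; rewrite ImM.
Qed.

Lemma meanJ f : bounded_measurable f ->
  mean (fun x => conjc (f x)) = conjc (mean f).
Proof.
move=> /bm_integrable[f1 f2]; have mI := measurable_I01.
apply: complex_eq; rewrite ?ReJ ?ImJ /=.
  by apply: eq_Rintegral => x _; rewrite ReJ.
rewrite -mulN1r -RintegralZl //; apply: eq_Rintegral => x _.
by rewrite ImJ mulN1r.
Qed.

(** The factor 2 comes from bounding the real and imaginary parts separately. *)
Lemma mean_le f M : bounded_measurable f -> (forall x, cnorm (f x) <= M) ->
  cnorm (mean f) <= 2 * M.
Proof.
move=> bf fM; have [f1 f2] := bm_integrable bf; have mI := measurable_I01.
have bound (h : R -> R) : mu.-integrable (@I01 R) (EFin \o h) ->
    (forall x, `|h x| <= M) -> `|Rintegral mu (@I01 R) h| <= M.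
  move=> hi hM; apply: le_trans (le_normr_Rintegral _ hi) _ => //.
  have cM : Rintegral mu (@I01 R) (cst M) = M.
    by rewrite Rintegral_cst //= lebesgue_I01 mulr1.
  rewrite -[X in _ <= X]cM; apply: le_Rintegral => //.
  - exact: integrable_norm.
  - by apply: (@bounded_integrable _ `|M|).
apply: le_trans (cnorm_le_ReIm _) _; rewrite mulr_natl mulr2n.
apply: lerD; apply: bound => // x.
  exact: le_trans (ler_Re_cnorm _) (fM x).
exact: le_trans (ler_Im_cnorm _) (fM x).
Qed.

Lemma mean1 : mean (fun=> 1) = 1 :> R[i].
Proof.
have mI := measurable_I01.
by apply: complex_eq; rewrite /= Rintegral_cst //= lebesgue_I01 mulr1.
Qed.

(** The fundamental theorem of calculus, for a primitive [H] with equal values at the two end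
    points. *)
Lemma Rintegral_periodic (h H : R -> R) :
  continuous h -> (forall x : R, is_derive x 1 H (h x)) -> H 0 = H 1 ->
  (forall x, `|h x| <= 1) -> Rintegral mu (@I01 R) h = 0.
Proof.
move=> ch dH H01 h1.
have ih : mu.-integrable (@I01 R) (EFin \o h).
  by apply: (bounded_integrable (M := 1)) => //; exact: continuous_measurable_fun.
rewrite /I01 Rintegral_itv_bndo_bndc // /Rintegral.
have cH x : {for x, continuous H}.
  by apply: differentiable_continuous; apply/derivable1_diffP; exact: ex_derive.
rewrite (@continuous_FTC2 _ h H) // ?H01 ?subee //.
- exact: continuous_subspaceT.
- split=> [x _|  |]; first exact: ex_derive.
  + by apply: cvg_at_right_filter; exact: cH.
  + by apply: cvg_at_left_filter; exact: cH.
- by move=> x _; rewrite derive1E derive_val.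
Qed.

Lemma mean_eTX n : (0 < n)%N -> mean (fun x => eT x ^+ n) = 0 :> R[i].
Proof.
move=> n0; pose a : R := 2 * pi * n%:R.
have a0 : a != 0.
  by rewrite !mulf_neq0 ?pnatr_eq0 ?gt_eqF ?pi_gt0 -?lt0n.
have e x : eT x ^+ n = Complex (cos (a * x)) (sin (a * x)).
  by rewrite eTX /eT mulrA.
have ca : continuous (fun x : R => cos (a * x)).
  move=> x; apply: continuous_comp; last exact: continuous_cos.
  by apply: continuousM; [exact: cvg_cst|exact: cvg_id].
have sa : continuous (fun x : R => sin (a * x)).
  move=> x; apply: continuous_comp; last exact: continuous_sin.
  by apply: continuousM; [exact: cvg_cst|exact: cvg_id].
have ea : eT (n%:R : R) = 1 by exact: eT_nat.
have [c1 s1] : cos a = 1 /\ sin a = 0 by case: ea.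
rewrite (eq_mean e); apply: complex_eq => /=.
  apply: (@Rintegral_periodic _ (fun x => a^-1 * sin (a * x))) => //.
  - move=> x; apply: is_derive_eq.
    by rewrite /GRing.scale /= mulr1; field.
  - by rewrite mulr0 mulr1 sin0 s1.
  - by move=> x; exact: cos_max.
apply: (@Rintegral_periodic _ (fun x => - a^-1 * cos (a * x))) => //.
- move=> x; apply: is_derive_eq.
  by rewrite /GRing.scale /= mulr1; field.
- by rewrite mulr0 mulr1 cos0 c1.
- by move=> x; exact: sin_max.
Qed.

Lemma mean_Xhorner p : mean (fun x => eT x * p.[eT x]) = 0.
Proof.
(* The power must be free in the induction, because splitting off a constant coefficient raises it
   by one. *)
suff H n : (0 < n)%N -> mean (fun x => eT x ^+ n * p.[eT x]) = 0.
  by rewrite -(H 1%N) //; apply: eq_mean => x; rewrite expr1.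
have bX m : bounded_measurable (fun x => eT x ^+ m).
  by have := bm_horner 'X^m; under eq_fun do rewrite hornerXn.
elim/poly_ind: p n => [|p c IHp] n n0.
  rewrite (eq_mean (g := fun x => 0 * 0)).
    by rewrite meanZ ?mul0r //; exact: bm_cst.
  by move=> x; rewrite horner0 !mulr0.
rewrite (eq_mean (g := fun x => eT x ^+ n.+1 * p.[eT x] + c * eT x ^+ n)).
  rewrite meanD ?IHp ?meanZ ?mean_eTX ?mulr0 ?addr0 //.
    by apply: bmM => //; exact: bm_horner.
  by apply: bmM => //; exact: bm_cst.
by move=> x; rewrite hornerMXaddC exprS; ring.
Qed.

(** Boundary values of functions in the disc algebra, described as uniform limits of polynomials on
    the circle; no values inside the disc occur. *)
Definition disc_algebra f : Prop := forall e : R, 0 < e ->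
  exists p, forall x, cnorm (f x - p.[eT x]) <= e.

Lemma disc_horner p : disc_algebra (fun x => p.[eT x]).
Proof. by move=> e e0; exists p => x; rewrite subrr cnorm0 ltW. Qed.

Lemma disc_bounded f : disc_algebra f -> exists2 M, 0 < M & forall x, cnorm (f x) <= M.
Proof.
move=> /(_ 1 ltr01)[p fp]; have [_ _ [M pM]] := bm_horner p.
exists (1 + `|M|); first by have := normr_ge0 M; lra.
move=> x; rewrite -[f x](subrK p.[eT x]); apply: le_trans (cnormD _ _) _.
by apply: lerD => //; apply: le_trans (pM x) (ler_norm _).
Qed.

Lemma disc_measurable f : disc_algebra f -> bounded_measurable f.
Proof.
move=> df; have [M _ fM] := disc_bounded df.
have /choice[p fp] : forall n : nat, exists p, forall x,
    cnorm (f x - p.[eT x]) <= n.+1%:R^-1.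
  by move=> n; apply: df; rewrite invr_gt0 ltr0n.
have cvg (phi : R[i] -> R) : (forall y z, `|phi y - phi z| <= cnorm (y - z)) ->
    forall x, (fun n => phi (p n).[eT x]) @ \oo --> phi (f x).
  move=> phiL x; apply/cvgrPdist_le => e e0.
  have := near_infty_natSinv_lt (PosNum e0); apply: filterS => n /= ne.
  apply: le_trans (phiL _ _) _; apply: le_trans (fp n x) (ltW ne).
split; last by exists M.
- apply: (@measurable_fun_cvg _ _ _ setT (fun n x => complex.Re (p n).[eT x])).
    by move=> n; case: (bm_horner (p n)).
  move=> x _; apply: (cvg (@complex.Re R)) => y z.
  by rewrite -ReN -ReD ler_Re_cnorm.
- apply: (@measurable_fun_cvg _ _ _ setT (fun n x => complex.Im (p n).[eT x])).
    by move=> n; case: (bm_horner (p n)).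
  move=> x _; apply: (cvg (@complex.Im R)) => y z.
  by rewrite -ImN -ImD ler_Im_cnorm.
Qed.

Lemma discD f g : disc_algebra f -> disc_algebra g ->
  disc_algebra (fun x => f x + g x).
Proof.
move=> df dg e e0; have e2 : 0 < e / 2 by lra.
have [p fp] := df _ e2; have [q gq] := dg _ e2; exists (p + q) => x.
rewrite hornerD opprD addrACA; apply: le_trans (cnormD _ _) _.
by have := fp x; have := gq x; lra.
Qed.

Lemma discM f g : disc_algebra f -> disc_algebra g ->
  disc_algebra (fun x => f x * g x).
Proof.
move=> df dg e e0.
have [M M0 fM] := disc_bounded df; have [N N0 gN] := disc_bounded dg.
(* The approximation [q] of [g] is chosen first, since the accuracy demanded of [p] depends on the
   size of [q]. *)
have e1 : 0 < e / 2 / M by rewrite !divr_gt0.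
have [q gq] := dg _ e1; have [_ _ [Q qQ]] := bm_horner q.
have Q0 : 0 < `|Q| + 1 by have := normr_ge0 Q; lra.
have e2 : 0 < e / 2 / (`|Q| + 1) by rewrite !divr_gt0.
have [p fp] := df _ e2; exists (p * q) => x; rewrite hornerM.
have -> : f x * g x - p.[eT x] * q.[eT x] =
    f x * (g x - q.[eT x]) + (f x - p.[eT x]) * q.[eT x] by ring.
apply: le_trans (cnormD _ _) _; rewrite !cnormM.
have h1 : cnorm (f x) * cnorm (g x - q.[eT x]) <= M * (e / 2 / M).
  by apply: ler_pM => //; exact: cnorm_ge0.
have h2 : cnorm (f x - p.[eT x]) * cnorm q.[eT x] <= e / 2 / (`|Q| + 1) * (`|Q| + 1).
  apply: ler_pM => //; try exact: cnorm_ge0.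
  by have := qQ x; have := ler_norm Q; lra.
rewrite divfK ?gt_eqF // in h2; rewrite [M * _]mulrC divfK ?gt_eqF // in h1; lra.
Qed.

Lemma disc_cst c : disc_algebra (fun=> c).
Proof. by have := disc_horner c%:P; under eq_fun do rewrite hornerC. Qed.

Lemma disc_limit f : (forall e : R, 0 < e -> exists2 g, disc_algebra g &
  forall x, cnorm (f x - g x) <= e) -> disc_algebra f.
Proof.
move=> H e e0; have e2 : 0 < e / 2 by lra.
have [g dg fg] := H _ e2; have [p gp] := dg _ e2; exists p => x.
by apply: le_trans (cnorm_triangle _ (g x) _) _; have := fg x; have := gp x; lra.
Qed.

(** The partial geometric sums converge uniformly: the remainder [f x ^+ n / (1 - f x)] is at most
    [r ^+ n / (1 - r)]. *)
Lemma disc_neumann f (r : R) : disc_algebra f -> (forall x, cnorm (f x) <= r) ->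
  r < 1 -> disc_algebra (fun x => (1 - f x)^-1).
Proof.
move=> df fr r1; have r0 : 0 <= r by apply: le_trans (fr 0); exact: cnorm_ge0.
have dX n : disc_algebra (fun x => f x ^+ n).
  elim: n => [|n IHn]; first exact: disc_cst.
  by under eq_fun do rewrite exprS; exact: discM.
have dS n : disc_algebra (fun x => \sum_(j < n) f x ^+ j).
  elim: n => [|n IHn]; first by under eq_fun do rewrite big_ord0; exact: disc_cst.
  by under eq_fun do rewrite big_ord_recr /=; exact: discD.
have den x : 1 - r <= cnorm (1 - f x).
  by apply: le_trans (cnorm_diff _ _); rewrite cnorm1; have := fr x; lra.
apply: disc_limit => e e0.
have [n hn] : exists n, r ^+ n <= e * (1 - r).
  have : (fun n => r ^+ n) @ \oo --> (0 : R) by apply: cvg_expr; rewrite ger0_norm.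
  have er : 0 < e * (1 - r) by rewrite mulr_gt0 // subr_gt0.
  move=> /cvgrPdist_le/(_ _ er)[n _ /(_ n (leqnn n))] /=.
  by rewrite sub0r normrN ger0_norm ?exprn_ge0 // => ?; exists n.
exists (fun x => \sum_(j < n) f x ^+ j) => // x.
have nz : 1 - f x != 0 by rewrite -cnorm_gt0; have := den x; lra.
have -> : (1 - f x)^-1 - \sum_(j < n) f x ^+ j = f x ^+ n / (1 - f x).
  apply: (mulfI nz); rewrite mulrBr divff // mulrCA divff // mulr1.
  have := subrX1 (f x) n; set S := \sum_(j < n) _ => E.
  by rewrite -[f x ^+ n](subrK 1) E; ring.
rewrite cnormM cnormV cnormX ler_pdivrMr ?cnorm_gt0 //.
apply: le_trans (_ : r ^+ n <= _).
  by rewrite lerXn2r ?nnegrE ?cnorm_ge0.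
by apply: le_trans hn _; rewrite ler_wpM2l // ltW.
Qed.

Lemma mean_Xdisc f : disc_algebra f -> mean (fun x => eT x * f x) = 0.
Proof.
move=> df; have bf := disc_measurable df; have be := bm_eT.
apply/eqP; rewrite -cnorm_eq0 eq_le cnorm_ge0 andbT; apply/ler_addgt0Pl => e e0.
rewrite addr0; have e2 : 0 < e / 2 by lra.
have [p fp] := df _ e2; have bp := bm_horner p.
have bd : bounded_measurable (fun x => f x - p.[eT x]).
  under eq_fun do rewrite -mulN1r; apply: bmD => //; apply: bmM => //; exact: bm_cst.
rewrite (eq_mean (g := fun x => eT x * (f x - p.[eT x]) + eT x * p.[eT x])).
  rewrite meanD ?mean_Xhorner ?addr0; [|exact: bmM|exact: bmM].
  have -> : e = 2 * (e / 2) by field.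
  apply: mean_le; first exact: bmM.
  by move=> x; rewrite cnormM cnorm_eT mul1r.
by move=> x; ring.
Qed.

End CircleMean.

(** * The Szego recursion and the Bernstein-Szego densities *)

Section SzegoRecursion.
Variables (R : realType) (al : nat -> R[i]).
Hypothesis al_le : forall n, cnorm (al n) <= 2^-1.
Implicit Types (n k M j : nat) (z : R[i]) (x : R) (p q : {poly R[i]}).

(* The monic polynomials [Phi_n], paired with [Psi n = Phi_n^*]. *)
Fixpoint szego n : {poly R[i]} * {poly R[i]} :=
  if n is m.+1 then
    let: (p, q) := szego m in
    ('X * p - (conjc (al m))%:P * q, q - (al m)%:P * ('X * p))
  else (1, 1).

Definition Phi n := (szego n).1.
Definition Psi n := (szego n).2.

Lemma PhiS n : Phi n.+1 = 'X * Phi n - (conjc (al n))%:P * Psi n.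
Proof. by rewrite /Phi /Psi /=; case: (szego n). Qed.

Lemma PsiS n : Psi n.+1 = Psi n - (al n)%:P * ('X * Phi n).
Proof. by rewrite /Phi /Psi /=; case: (szego n). Qed.

Lemma szego_size n :
  [/\ size (Phi n) = n.+1, Phi n \is monic & (size (Psi n) <= n.+1)%N].
Proof.
elim: n => [|n [IH1 IH2 IH3]].
  by rewrite /Phi /Psi /= size_poly1 monic1.
have sX : size ('X * Phi n) = n.+2 by rewrite mulrC size_mulX ?IH1 // -size_poly_eq0 IH1.
have sP : (size (- ((conjc (al n))%:P * Psi n))%R < size ('X * Phi n)%R)%N.
  rewrite sX size_polyN mul_polyC.
  by apply: leq_ltn_trans (size_scale_leq _ _) _; rewrite ltnS.
split.
- by rewrite PhiS size_polyDl.
- by rewrite PhiS monicE lead_coefDl // -monicE monicMl ?monicX.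
- rewrite PsiS; apply: leq_trans (size_polyD _ _) _; rewrite geq_max.
  rewrite (leq_trans IH3) //= size_polyN mul_polyC -sX; exact: size_scale_leq.
Qed.

(** This identifies [Psi n] with the reversed polynomial on the circle, and decouples the recursion
    into one for [Psi] alone. *)
Lemma Phi_circle n z : cnorm z = 1 -> (Phi n).[z] = z ^+ n * conjc (Psi n).[z].
Proof.
move=> z1; elim: n => [|n IHn].
  by rewrite /Phi /Psi /= !hornerC conjc1 mulr1.
rewrite PhiS PsiS !(hornerD, hornerN, hornerM, hornerC, hornerX) IHn.
rewrite conjcB !conjcM conjcK.
have zz := unitJ n z1; have z' := unitJ 1 z1; rewrite expr1 in z'.
transitivity (z * z ^+ n * conjc (Psi n).[z] -
    (z ^+ n * conjc (z ^+ n)) * (z * conjc z) * conjc (al n) * (Psi n).[z]).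
  by rewrite zz z'; ring.
by rewrite [z ^+ n.+1]exprS; ring.
Qed.

Lemma Psi_circleS n z : cnorm z = 1 ->
  (Psi n.+1).[z] = (Psi n).[z] - al n * z ^+ n.+1 * conjc (Psi n).[z].
Proof.
move=> z1; rewrite PsiS !(hornerD, hornerN, hornerM, hornerC, hornerX).
by rewrite Phi_circle // [z ^+ n.+1]exprS; ring.
Qed.

Lemma cnorm_Phi n z : cnorm z = 1 -> cnorm (Phi n).[z] = cnorm (Psi n).[z].
Proof. by move=> z1; rewrite Phi_circle // cnormM cnormX z1 expr1n mul1r cnormJ. Qed.

Lemma Psi_neq0 n z : cnorm z = 1 -> (Psi n).[z] != 0.
Proof.
move=> z1; elim: n => [|n IHn]; first by rewrite /Psi /= hornerC oner_eq0.
rewrite -cnorm_gt0 Psi_circleS //; apply: lt_le_trans (cnorm_diff _ _).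
rewrite !cnormM cnormJ cnormX z1 expr1n mulr1 subr_gt0.
rewrite -cnorm_gt0 in IHn; have := ler_wpM2r (ltW IHn) (al_le n); lra.
Qed.

(** [Psi n.+1] is [Psi n] times [1 - f], and [f] has modulus [cnorm (al n) <= 1/2] because [Phi n]
    and [Psi n] have equal moduli on the circle. The Neumann series applies. *)
Lemma disc_Psi_inv n : disc_algebra (fun x => (Psi n).[eT x]^-1).
Proof.
elim: n => [|n IHn].
  by rewrite /Psi /=; under eq_fun do rewrite hornerC invr1; exact: disc_cst.
pose f x : R[i] := ((al n)%:P * ('X * Phi n)).[eT x] * (Psi n).[eT x]^-1.
have df : disc_algebra f by apply: discM => //; exact: disc_horner.
have f2 x : cnorm (f x) <= 2^-1.
  rewrite /f !(hornerD, hornerN, hornerM, hornerC, hornerX) cnormM cnormV !cnormM cnorm_eT mul1r.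
  rewrite cnorm_Phi ?cnorm_eT // mulfK // cnorm_eq0 Psi_neq0 //; exact: cnorm_eT.
have h1 : 2^-1 < 1 :> R by lra.
have := discM IHn (disc_neumann df f2 h1).
congr disc_algebra; apply/funext => x; rewrite -invfM; congr (_^-1).
have nz : (Psi n).[eT x] != 0 by apply: Psi_neq0; exact: cnorm_eT.
by rewrite PsiS hornerD hornerN /f mulrBr mulr1 mulrCA divff // mulr1.
Qed.

Lemma Psi_const n : exists r, Psi n = 1 + 'X * r.
Proof.
elim: n => [|n [r IHr]]; first by exists 0; rewrite mulr0 addr0.
by exists (r - (al n)%:P * Phi n); rewrite PsiS IHr; ring.
Qed.

(** The inverse of [Psi n] behaves as an analytic function with value 1 at the origin: positive
    powers of [eT x] annihilate it, and [Psi n = 1 + 'X * r] reduces [j = 0] to the mean of 1. *)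
Lemma mean_eTX_Psi_inv n j :
  mean (fun x => eT x ^+ j / (Psi n).[eT x]) = (j == 0%N)%:R.
Proof.
have H g : disc_algebra g -> mean (fun x => eT x * g x / (Psi n).[eT x]) = 0.
  move=> dg; rewrite -(mean_Xdisc (discM dg (disc_Psi_inv n))).
  by apply: eq_mean => x; rewrite mulrA.
case: j => [|j]; last first.
  rewrite -[RHS](H (fun x => ('X^j).[eT x])); last exact: disc_horner.
  by apply: eq_mean => x; rewrite exprS hornerXn.
have [r Pr] := Psi_const n.
have nz x : (Psi n).[eT x] != 0 by apply: Psi_neq0; exact: cnorm_eT.
rewrite -[RHS](mean1 R) (eq_mean (f := fun=> 1)
  (g := fun x => 1 / (Psi n).[eT x] + eT x * r.[eT x] / (Psi n).[eT x])).
  rewrite meanD.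
  - by rewrite (H (fun x => r.[eT x])) ?addr0 //; exact: disc_horner.
  - under eq_fun do rewrite mul1r; exact: disc_measurable (disc_Psi_inv n).
  - apply: bmM; last exact: disc_measurable (disc_Psi_inv n).
    by apply: bmM; [exact: bm_eT|exact: bm_horner].
move=> x; rewrite -mulrDl.
rewrite (_ : 1 + _ = (Psi n).[eT x]) ?divff // Pr.
by rewrite !(hornerD, hornerM, hornerC, hornerX).
Qed.

(** The squared norm of [Phi n]. *)
Definition szprod n : R := \prod_(j < n) (1 - cnorm (al j) ^+ 2).

Lemma szfactor_gt0 n : 0 < 1 - cnorm (al n) ^+ 2.
Proof. by have := al_le n; have := cnorm_ge0 (al n); nra. Qed.

Lemma szprod_gt0 n : 0 < szprod n.
Proof. by apply: prodr_gt0 => j _; exact: szfactor_gt0. Qed.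

Lemma szprodS n : szprod n.+1 = szprod n * (1 - cnorm (al n) ^+ 2).
Proof. by rewrite /szprod big_ord_recr. Qed.

(* Density of the Bernstein-Szego measure [dm / |phi_M|^2]. *)
Definition bsweight M x : R := szprod M / cnorm (Psi M).[eT x] ^+ 2.

Lemma bsweightE M x : (bsweight M x)%:C =
  (szprod M)%:C * ((Psi M).[eT x]^-1 * conjc ((Psi M).[eT x]^-1)).
Proof. by rewrite mulrJ cnormV /bsweight rmorphM /= exprVn. Qed.

Lemma bm_bsweight M : bounded_measurable (fun x => (bsweight M x)%:C).
Proof.
under eq_fun do rewrite bsweightE.
have b := disc_measurable (disc_Psi_inv M).
by apply: bmM; [exact: bm_cst|apply: bmM => //; exact: bmJ].
Qed.

Lemma bm_eTX j : bounded_measurable (fun x : R => eT x ^+ j).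
Proof.
have := bm_horner ('X^j : {poly R[i]}); congr bounded_measurable.
by apply/funext => x; rewrite hornerXn.
Qed.

(* Orthogonality is immediate at the top degree [n = M], and it is transported
   down to [n < M] by inverting the recursion. *)
Lemma bs_orthogonal M n j : (n <= M)%N -> (j <= n)%N ->
  mean (fun x => (Phi n).[eT x] * conjc (eT x ^+ j) * (bsweight M x)%:C) =
  (if j == n then szprod n else 0)%:C.
Proof.
move=> nM; move: (nM); rewrite -{1}(subKn nM); move: (leq_subr n M).
set d := (M - n)%N => dM _.
have {nM} -> : n = (M - d)%N by rewrite subKn.
have bw := bm_bsweight M.
have bP p k : bounded_measurable (fun x => p.[eT x] * conjc (eT x ^+ k) * (bsweight M x)%:C).
  by apply: bmM => //; apply: bmM; [exact: bm_horner|exact/bmJ/bm_eTX].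
elim: d j dM => [|d IHd] j dM jn.
  rewrite subn0 in jn *.
  have nz x : (Psi M).[eT x] != 0 by apply: Psi_neq0; exact: cnorm_eT.
  (* At the top degree the conjugate of [Psi M] in [Phi M] cancels one factor of the density, which
     leaves an analytic integrand. *)
  rewrite (eq_mean (g := fun x => (szprod M)%:C *
    (eT x ^+ (M - j) / (Psi M).[eT x]))); last first.
    move=> x; rewrite bsweightE Phi_circle ?cnorm_eT // -{1}(subnK jn) exprD.
    have e1 := unitJ j (cnorm_eT x).
    have e2 : conjc (Psi M).[eT x] * conjc ((Psi M).[eT x]^-1) = 1.
      by rewrite -conjcM divff // conjc1.
    by rewrite -[RHS]mulr1 -[X in _ = _ * X]e1 -[RHS]mulr1 -[X in _ = _ * X]e2; ring.
  rewrite meanZ; last first.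
    by apply: bmM; [exact: bm_eTX|exact: disc_measurable (disc_Psi_inv M)].
  rewrite mean_eTX_Psi_inv subn_eq0; case: eqP => [->|/eqP ne].
    by rewrite leqnn mulr1.
  by rewrite leqNgt ltn_neqAle ne jn mulr0.
set n' := (M - d.+1)%N in jn *.
have nS : (M - d)%N = n'.+1 by rewrite /n'; lia.
rewrite nS in IHd; have dM' : (d <= M)%N by lia.
have r0 := szfactor_gt0 n'.
have rC : (1 - cnorm (al n') ^+ 2)%:C != 0 :> R[i].
  by rewrite -cnorm_gt0 cnormR normr_gt0 gt_eqF.
apply: (mulfI rC); rewrite -meanZ //.
(* The recursion is inverted: [1 - cnorm (al n') ^+ 2] times ['X * Phi n'] is [Phi n'.+1] plus
   [conjc (al n')] times [Psi n'.+1]. On the circle the last term is rewritten as a conjugate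
   involving [Phi n'.+1]. *)
rewrite (eq_mean (g := fun x =>
  (Phi n'.+1).[eT x] * conjc (eT x ^+ j.+1) * (bsweight M x)%:C +
  conjc (al n') * conjc ((Phi n'.+1).[eT x] * conjc (eT x ^+ (n' - j)) * (bsweight M x)%:C)));
  last first.
  move=> x; rewrite !conjcM conjcK conjc_real.
  have x1 := cnorm_eT x.
  have PsiE : conjc (Phi n'.+1).[eT x] * eT x ^+ (n' - j) =
      (Psi n'.+1).[eT x] * conjc (eT x ^+ j.+1).
    rewrite Phi_circle // conjcM conjcK.
    have -> : conjc (eT x ^+ n'.+1) = conjc (eT x ^+ (n' - j)) * conjc (eT x ^+ j.+1).
      by rewrite -conjcM -exprD addnS subnK.
    by rewrite -[RHS]mul1r -(unitJ (n' - j) x1); ring.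
  rewrite PsiE PhiS PsiS !(hornerD, hornerN, hornerM, hornerC, hornerX).
  rewrite [eT x ^+ j.+1]exprS conjcM.
  have xx := unitJ 1 x1; rewrite expr1 in xx.
  have -> : (1 - cnorm (al n') ^+ 2)%:C = 1 - al n' * conjc (al n').
    by rewrite rmorphB /= mulrJ.
  by rewrite -[LHS]mul1r -[X in X * _ = _]xx; ring.
rewrite meanD ?meanZ ?meanJ //; last 2 first.
- exact: bmJ.
- by apply: bmM; [exact: bm_cst|exact: bmJ].
rewrite IHd // IHd //; last by lia.
rewrite eqSS (_ : (n' - j == n'.+1)%N = false); last by lia.
rewrite conjc_real mulr0 addr0; case: eqP => _; last by rewrite mulr0.
by rewrite szprodS rmorphM /= mulrC.
Qed.

(** * Orthonormal polynomials of the limit density, and their uniqueness *)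

Section LimitWeight.
Variable w : R -> R.
Hypothesis bw : bounded_measurable (fun x => (w x)%:C).
Hypothesis w_lim : forall n (e : R), 0 < e ->
  exists2 M, (n <= M)%N & forall x, `|w x - bsweight M x| <= e.

Definition inner p q : R[i] :=
  mean (fun x => p.[eT x] * conjc q.[eT x] * (w x)%:C).

Lemma bm_inner p q :
  bounded_measurable (fun x => p.[eT x] * conjc q.[eT x] * (w x)%:C).
Proof. by apply: bmM => //; apply: bmM; [|apply: bmJ]; exact: bm_horner. Qed.

Lemma innerDl p1 p2 q : inner (p1 + p2) q = inner p1 q + inner p2 q.
Proof.
rewrite /inner -meanD; [|exact: bm_inner..].
by apply: eq_mean => x; rewrite hornerD !mulrDl.
Qed.

Lemma innerZl c p q : inner (c *: p) q = c * inner p q.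
Proof.
rewrite /inner -meanZ; last exact: bm_inner.
by apply: eq_mean => x; rewrite hornerZ !mulrA.
Qed.

Lemma innerJ p q : inner q p = conjc (inner p q).
Proof.
rewrite /inner -meanJ; last exact: bm_inner.
by apply: eq_mean => x; rewrite !conjcM conjcK conjc_real; ring.
Qed.

Lemma innerDr p q1 q2 : inner p (q1 + q2) = inner p q1 + inner p q2.
Proof. by rewrite innerJ innerDl conjcD -!innerJ. Qed.

Lemma innerZr c p q : inner p (c *: q) = conjc c * inner p q.
Proof. by rewrite innerJ innerZl conjcM -innerJ. Qed.

(** The value for the density of index [M] is the same for every [M >= n], so it passes to the
    uniform limit. *)
Lemma inner_Phi_Xn n j : (j <= n)%N ->
  inner (Phi n) 'X^j = (if j == n then szprod n else 0)%:C.
Proof.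
move=> jn; apply/eqP; rewrite -subr_eq0 -cnorm_eq0 eq_le cnorm_ge0 andbT.
apply/ler_addgt0Pl => e e0; rewrite addr0.
have [_ _ [B PB]] := bm_horner (Phi n * 'X^j).
have B0 : 0 < 2 * (`|B| + 1) by have := normr_ge0 B; lra.
have [M nM wM] := w_lim n (divr_gt0 e0 B0).
rewrite -(bs_orthogonal nM jn) /inner.
have bP (h : R -> R[i]) : bounded_measurable h ->
    bounded_measurable (fun x => (Phi n).[eT x] * conjc ('X^j).[eT x] * h x).
  by move=> bh; apply: bmM => //; apply: bmM; [|apply: bmJ]; exact: bm_horner.
have bd : bounded_measurable (fun x => (w x - bsweight M x)%:C).
  under eq_fun do rewrite rmorphB /= -mulN1r.
  by apply: bmD => //; apply: bmM; [exact: bm_cst|exact: bm_bsweight].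
rewrite (eq_mean (g := fun x =>
   (Phi n).[eT x] * conjc ('X^j).[eT x] * (bsweight M x)%:C +
   (Phi n).[eT x] * conjc ('X^j).[eT x] * (w x - bsweight M x)%:C)); last first.
  by move=> x; rewrite rmorphB /=; ring.
rewrite meanD; [|apply: bP; exact: bm_bsweight|exact: bP].
rewrite (eq_mean (f := fun x => _ * conjc (eT x ^+ j) * _) (g := fun x =>
  (Phi n).[eT x] * conjc ('X^j).[eT x] * (bsweight M x)%:C)); last first.
  by move=> x; rewrite hornerXn.
rewrite addrC addKr.
have -> : e = 2 * (e / 2) by field.
apply: mean_le; first exact: bP.
move=> x; rewrite !cnormM cnormJ -cnormM -hornerM cnormR.
apply: (@le_trans _ _ ((`|B| + 1) * (e / (2 * (`|B| + 1))))).
  apply: ler_pM => //; first exact: cnorm_ge0.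
  by have := PB x; have := ler_norm B; lra.
have b1 : `|B| + 1 != 0 by rewrite gt_eqF //; have := normr_ge0 B; lra.
by rewrite le_eqVlt; apply/orP; left; apply/eqP; field.
Qed.

Lemma inner_Phi n q : (size q <= n.+1)%N ->
  inner (Phi n) q = conjc q`_n * (szprod n)%:C.
Proof.
move=> sq; have qE : q = \sum_(j < n.+1) q`_j *: 'X^j.
  by rewrite -poly_def -{1}[q](take_poly_id sq).
have S (I : seq 'I_n.+1) : inner (Phi n) (\sum_(j <- I) q`_j *: 'X^j) =
    \sum_(j <- I) conjc q`_j * inner (Phi n) 'X^j.
  elim: I => [|j I IH]; last by rewrite !big_cons innerDr innerZr IH.
  by rewrite !big_nil -(scale0r 0) innerZr conjc0 mul0r.
rewrite {1}qE S (bigD1 ord_max) //= big1 ?addr0; first by rewrite inner_Phi_Xn // eqxx.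
move=> i ni; have iN : (i <= n)%N by rewrite -ltnS.
have /negbTE i_n : (i != n :> nat) by move: ni; rewrite -val_eqE.
by rewrite inner_Phi_Xn // i_n mulr0.
Qed.

Definition phin n : {poly R[i]} := ((Num.sqrt (szprod n))^-1)%:C *: Phi n.

Lemma phin_size n : size (phin n) = n.+1 /\ 0 < lead_coef (phin n).
Proof.
have [s1 s2 _] := szego_size n.
have c0 : 0 < (Num.sqrt (szprod n))^-1 by rewrite invr_gt0 sqrtr_gt0 szprod_gt0.
split.
  by rewrite size_scale // -cnorm_gt0 cnormR normr_gt0 gt_eqF.
by rewrite lead_coefZ (monicP s2) mulr1 ltcR.
Qed.

Lemma inner_phin n k : inner (phin n) (phin k) = (n == k)%:R.
Proof.
have le a b : (b <= a)%N -> inner (phin a) (phin b) = (a == b)%:R.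
  move=> ba; have [s1 s2 _] := szego_size b.
  rewrite /phin innerZl innerZr conjc_real inner_Phi ?s1 //.
  case: eqP => [->|/eqP ne].
    have -> : (Phi b)`_b = 1.
      by have /eqP := s2; rewrite lead_coefE s1.
    rewrite conjc1 mul1r -!rmorphM /=.
    have h := sqr_sqrtr (ltW (szprod_gt0 b)).
    have h0 : Num.sqrt (szprod b) != 0 by rewrite gt_eqF // sqrtr_gt0 szprod_gt0.
    by rewrite -{3}h expr2 mulKf // mulVf.
  rewrite (_ : (Phi b)`_a = 0) ?conjc0 ?mul0r ?mulr0 //.
  by rewrite nth_default // s1 ltn_neqAle eq_sym ne.
have [/le //|/ltnW kn] := leqP k n.
by rewrite innerJ le // eq_sym; case: eqP => _; rewrite ?conjc1 ?conjc0.
Qed.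

Definition orthonormal_system (psi : nat -> {poly R[i]}) : Prop :=
  (forall n, size (psi n) = n.+1 /\ 0 < lead_coef (psi n)) /\
  (forall n k, inner (psi n) (psi k) = (n == k)%:R).

Lemma cancel_lead p q m : (size p <= m.+1)%N -> size q = m.+1 ->
  (size (p - (p`_m / q`_m) *: q)%R <= m)%N.
Proof.
move=> sp sq; have q0 : q`_m != 0.
  have -> : q`_m = lead_coef q by rewrite lead_coefE sq.
  by rewrite lead_coef_eq0 -size_poly_eq0 sq.
apply/leq_sizeP => j; rewrite leq_eqVlt => /predU1P[<-|mj].
  by rewrite coefB coefZ divfK // subrr.
have pj : p`_j = 0 by apply: nth_default; exact: leq_trans sp mj.
have qj : q`_j = 0 by apply: nth_default; rewrite sq.
by rewrite coefB coefZ pj qj mulr0 subr0.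
Qed.

(** Subtracting multiples of [psi m] with [m < n] removes the leading terms of [p] one by one
    without changing the inner product. *)
Lemma orthonormal_lower psi n p : orthonormal_system psi -> (size p <= n)%N ->
  inner (psi n) p = 0.
Proof.
move=> [sz on].
suff H m : (m <= n)%N -> forall p, (size p <= m)%N -> inner (psi n) p = 0.
  exact: H (leqnn n) p.
elim: m => [|m IHm] mn {}p sp.
  have -> : p = 0 by apply/eqP; rewrite -size_poly_eq0 -leqn0.
  by rewrite -(scale0r 0) innerZr conjc0 mul0r.
rewrite -[X in inner _ X](subrK ((p`_m / (psi m)`_m) *: psi m)) innerDr innerZr on.
rewrite gtn_eqF //= mulr0 addr0; apply: IHm; first exact: ltnW.
by apply: cancel_lead => //; case: (sz m).
Qed.

(** Pairing with [psi m] reads off the component of [p] along [psi m]; its vanishing lowers the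
    degree. *)
Lemma orthonormal_complete psi m p : orthonormal_system psi -> (size p <= m)%N ->
  (forall k, (k < m)%N -> inner p (psi k) = 0) -> p = 0.
Proof.
move=> os; have [sz on] := os; elim: m p => [|m IHm] p sp op.
  by apply/eqP; rewrite -size_poly_eq0 -leqn0.
have [sm _] := sz m; pose c := p`_m / (psi m)`_m.
have sD := cancel_lead sp sm; rewrite -/c in sD.
have c0 : c = 0.
  have := op m (ltnSn m); rewrite -[X in inner X _](subrK (c *: psi m)) innerDl innerZl on.
  by rewrite eqxx mulr1 innerJ (orthonormal_lower os sD) conjc0 add0r.
move: sD; rewrite c0 scale0r subr0 => sD; apply: IHm => // k km.
by apply: op; exact: ltnW.
Qed.

(** The ratio [c] of the leading coefficients is positive, and the norms force [conjc c * c = 1], so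
    [c = 1]. The difference then has lower degree and is orthogonal to all lower [phin k]. *)
Lemma orthonormal_unique psi : orthonormal_system psi -> psi =1 phin.
Proof.
move=> os n; have os' : orthonormal_system phin.
  by split; [exact: phin_size|exact: inner_phin].
have [sz on] := os; have [s1 l1] := sz n; have [s2 l2] := phin_size n.
pose c := (psi n)`_n / (phin n)`_n.
have sD : (size (psi n - c *: phin n)%R <= n)%N by apply: cancel_lead => //; rewrite s1.
have cpos : 0 < c.
  rewrite /c (_ : (psi n)`_n = lead_coef (psi n)); last by rewrite lead_coefE s1.
  by rewrite (_ : (phin n)`_n = lead_coef (phin n)) ?divr_gt0 // lead_coefE s2.
have e1 : inner (phin n) (psi n) = conjc c.
  rewrite -[psi n](subrK (c *: phin n)) innerDr (orthonormal_lower os' sD) add0r.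
  by rewrite innerZr inner_phin eqxx mulr1.
have e2 : conjc c * c = 1.
  have := on n n; rewrite eqxx /= -{2}[psi n](subrK (c *: phin n)) innerDr.
  by rewrite (orthonormal_lower os sD) add0r innerZr innerJ e1 conjcK.
have c1 : c = 1.
  case: (c) cpos e2 => a b; rewrite ltcE /= => /andP[/eqP -> a0].
  rewrite oppr0 => /(congr1 (@complex.Re R)) /=; rewrite mulr0 subr0 => aa.
  by have -> : a = 1 by nra.
rewrite c1 scale1r in sD; apply/eqP; rewrite -subr_eq0; apply/eqP.
apply: (orthonormal_complete os' sD) => k kn.
rewrite innerDl -scaleN1r innerZl inner_phin gtn_eqF //= mulr0 addr0.
by apply: orthonormal_lower => //; case: (phin_size k) => ->.
Qed.

End LimitWeight.
End SzegoRecursion.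

(** * The measure with a given bounded density *)

Section DensityMeasure.
Variables (R : realType) (w : R -> R) (B : R).
Notation mu := (@lebesgue_measure R).
Hypothesis mw : measurable_fun setT w.
Hypothesis w_ge0 : forall x, 0 <= w x.
Hypothesis w_le : forall x, w x <= B.

Let dens : R -> R := w \_ (@I01 R).

Let dens_ge0 x : 0 <= dens x.
Proof. by rewrite /dens patchE; case: ifP. Qed.

Let measurable_dens : measurable_fun setT (EFin \o dens).
Proof.
apply/measurable_EFinP; apply/(measurable_restrictT w).
  exact: measurable_I01.
exact: measurable_funTS.
Qed.

Definition density_measure (A : set (measurableTypeR R)) : \bar R :=
  (\int[mu]_(x in A) (dens x)%:E)%E.

Let density0 : density_measure set0 = 0%E.
Proof. by rewrite /density_measure integral_set0. Qed.

Let density_ge0 A : (0 <= density_measure A)%E.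
Proof. by apply: integral_ge0 => x _; rewrite lee_fin. Qed.

Let density_sigma_additive : semi_sigma_additive density_measure.
Proof.
move=> /= F mF tF mUF; rewrite /density_measure; apply: cvg_toP.
  apply: ereal_nondecreasing_is_cvgn => m n mn.
  by apply: lee_sum_nneg_natr => // k _ _; exact: density_ge0.
rewrite ge0_integral_bigcup //=.
- by apply: measurable_funTS; exact: measurable_dens.
- by move=> x _; rewrite lee_fin.
Qed.

HB.instance Definition _ := isMeasure.Build _ _ _ density_measure
  density0 density_ge0 density_sigma_additive.

Lemma density_measureE (A : set (measurableTypeR R)) : measurable A -> A `<=` @I01 R ->
  density_measure A = (\int[mu]_(x in A) (w x)%:E)%E.
Proof.
move=> mA AI; apply: eq_integral => x /[!inE] Ax.
by rewrite /dens patchE mem_set //; exact: AI.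
Qed.

Lemma density_measureC : density_measure (~` @I01 R) = 0%E.
Proof.
rewrite /density_measure; under eq_integral => x /[!inE] xI.
  rewrite /dens patchE memNset //; over.
exact: integral0.
Qed.

Let integrable_dens : mu.-integrable setT (EFin \o dens).
Proof.
rewrite /dens -restrict_EFin; apply/integrable_restrict => //.
  exact: measurable_I01.
rewrite setTI; apply: (bounded_integrable (M := B)) => // x.
by rewrite ger0_norm.
Qed.

Let density_fin : fin_num_fun density_measure.
Proof.
move=> U mU; apply: integrable_fin_num => //.
exact: integrableS integrable_dens.
Qed.

HB.instance Definition _ := Measure_isFinite.Build _ _ _ density_measure
  density_fin.

Let density_dominated : density_measure `<< mu.
Proof.
apply/null_content_dominatesP => A mA muA0.
apply: null_set_integral => //; apply: measurable_funTS; exact: measurable_dens.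
Qed.

(** Change of variables through the Radon-Nikodym derivative, which agrees with [dens] almost
    everywhere because both have the same integrals over measurable sets. *)
Let integral_density (h : R -> \bar R) (U : set (measurableTypeR R)) :
  measurable U -> density_measure.-integrable U h ->
  (\int[density_measure]_(x in U) h x = \int[mu]_(x in U) (h x * (dens x)%:E))%E.
Proof.
move=> mU ih.
rewrite -(Radon_Nikodym_change_of_variables density_dominated) //=.
have mh := measurable_int _ ih.
have mRN : measurable_fun U
    (Radon_Nikodym (charge_of_finite_measure density_measure) mu).
  apply: (measurable_int mu); apply: (integrableS _ _ (@subsetT _ _)) => //=.
  by apply: Radon_Nikodym_integrable; exact: density_dominated.
apply: ae_eq_integral => //.
- exact: emeasurable_funM.
- by apply: emeasurable_funM => //; apply: measurable_funTS; exact: measurable_dens.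
- apply: ae_eqe_mul2l => /=.
  rewrite (Radon_NikodymE (nu := charge_of_finite_measure density_measure)
    density_dominated); case: cid => /= g [g1 g2 g3]; apply: integral_ae_eq => //=.
  + exact: integrableS g2.
  + by apply: measurable_funTS; exact: measurable_dens.
  + by move=> E EU mE; rewrite -g3.
Qed.

(** The pushforward under this identity moves the measure from the copy of the line carrying
    Lebesgue measure to the one on which [sigma] is sought. *)
Let idR : measurableTypeR R -> R := idfun.

Let measurable_idR : measurable_fun setT idR.
Proof. exact: (@measurable_id _ (measurableTypeR R)). Qed.

Let sigma : {measure set R -> \bar R} :=
  measure_function_pushforward__canonical__measure_function_Measure
    density_measure measurable_idR.

Let Rintegral_density (h : R -> R) M : measurable_fun setT h ->
  (forall x, `|h x| <= M) ->
  Rintegral sigma (@I01 R) h =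
  Rintegral mu (@I01 R) (fun x => h x * w x).
Proof.
move=> mh hM; have mI := @measurable_I01 R.
have ih : density_measure.-integrable (@I01 R) (EFin \o h).
  apply: measurable_bounded_integrable => //.
  - by rewrite -ge0_fin_numE //; exact: density_fin.
  - exact: measurable_funTS.
  - exists M; split; first exact: num_real.
    by move=> y My x _ /=; apply: le_trans (hM x) (ltW My).
rewrite /Rintegral (integral_pushforward measurable_idR) //; last first.
  exact/measurable_EFinP.
congr fine; rewrite (integral_density mI ih); apply: eq_integral => x xI.
by rewrite /dens patchE xI EFinM.
Qed.

Lemma density_exists : exists sigma : {measure set R -> \bar R},
  [/\ forall A : set R, measurable A -> A `<=` @I01 R ->
        sigma A = (\int[mu]_(x in A) (w x)%:E)%E,
      sigma (~` @I01 R) = 0%E &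
      forall f, bounded_measurable f -> cint sigma f = mean (fun x => f x * (w x)%:C)].
Proof.
exists sigma.
split; [exact: density_measureE|exact: density_measureC|].
move=> f [f1 f2 [M fM]]; apply: complex_eq => /=.
  rewrite (Rintegral_density (M := M)) //; last first.
    by move=> x; apply: le_trans (ler_Re_cnorm _) (fM x).
  by apply: eq_Rintegral => x _; rewrite ReM /= mulr0 subr0.
rewrite (Rintegral_density (M := M)) //; last first.
  by move=> x; apply: le_trans (ler_Im_cnorm _) (fM x).
by apply: eq_Rintegral => x _; rewrite ImM /= mulr0 add0r.
Qed.

End DensityMeasure.

(** * Concatenation of infinitely many finite sequences *)

Section Concatenation.
Variables (T : Type) (t0 : T) (n : nat -> nat) (l : nat -> nat -> T).
Hypothesis n_gt0 : forall s, (0 < n s)%N.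

Let pre s := flatten [seq mkseq (l i) (n i) | i <- iota 0 s].

Let preS s : pre s.+1 = pre s ++ mkseq (l s) (n s).
Proof.
by rewrite /pre -addn1 iotaD map_cat flatten_cat /= cats0 add0n.
Qed.

Let size_pre s : (s <= size (pre s))%N.
Proof.
elim: s => [//|s IHs]; rewrite preS size_cat size_mkseq -addn1.
exact: leq_add.
Qed.

Let pre_prefix s r : exists t, pre (s + r) = pre s ++ t.
Proof.
elim: r => [|r [t IHr]]; first by exists [::]; rewrite addn0 cats0.
by exists (t ++ mkseq (l (s + r)) (n (s + r))); rewrite addnS preS IHr catA.
Qed.

Lemma concat_exists : exists (a : nat -> T) (S : nat -> nat),
  [/\ S 0%N = 0%N, forall s, S s.+1 = (S s + n s)%N, forall s, (s <= S s)%N,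
      forall s i, (i < n s)%N -> a (S s + i)%N = l s i &
      forall m, exists s i, a m = l s i].
Proof.
(* Stages are nonempty, so the first [m.+1] of them contain more than [m] terms and the default [t0]
   is never read. *)
exists (fun m => nth t0 (pre m.+1) m), (fun s => size (pre s)).
have nthE s m : (m < size (pre s))%N -> nth t0 (pre m.+1) m = nth t0 (pre s) m.
  move=> ms; have m1 := size_pre m.+1.
  have [sm|ms'] := leqP s m.+1.
    have [t E] := pre_prefix s (m.+1 - s); rewrite subnKC // in E.
    by rewrite E nth_cat ms.
  have [t E] := pre_prefix m.+1 (s - m.+1); rewrite subnKC ?(ltnW ms') // in E.
  by rewrite E nth_cat m1.
split=> //.
- by move=> s; rewrite preS size_cat size_mkseq.
- move=> s i si; rewrite (nthE s.+1) preS ?size_cat ?size_mkseq ?ltn_add2l //.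
  by rewrite nth_cat ltnNge leq_addr /= addKn nth_mkseq.
move=> m; suff H s k : (k < size (pre s))%N ->
    exists s' i, nth t0 (pre s) k = l s' i by exact: H (size_pre m.+1).
elim: s => [//|s IHs]; rewrite preS size_cat size_mkseq nth_cat.
have [ks _|ks kn] := ltnP k (size (pre s)); first exact: IHs.
by exists s, (k - size (pre s))%N; rewrite nth_mkseq // ltn_subLR.
Qed.

End Concatenation.

(** * Limits under geometrically decreasing relative changes *)

Section DyadicLimit.
Variable R : realType.
Implicit Types x : nat -> R.

(** The margins [2^-1 ^+ s.+1] and [2^-1 ^+ s] are the room reserved for the remaining steps. *)
Lemma dyadic_bounds x : x 0%N = 1 ->
  (forall s, `|x s.+1 - x s| <= 2^-1 ^+ (s + 3) * x s) ->
  forall s, 2^-1 + 2^-1 ^+ s.+1 <= x s <= 2 - 2^-1 ^+ s.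
Proof.
move=> x0 H; elim=> [|s /andP[IH1 IH2]].
  by rewrite x0 expr1 expr0; apply/andP; split; lra.
have := H s; rewrite addnC !exprS ler_norml => /andP[h1 h2].
rewrite exprS in IH1; set p := 2^-1 ^+ s in IH1 IH2 h1 h2 *.
have p0 : 0 < p by rewrite exprn_gt0.
have px : p * x s <= p * 2 by apply: ler_wpM2l; lra.
by apply/andP; split; lra.
Qed.

(** The intervals of radius [2^-1 ^+ s.+1] around [x s] are nested; the limit is the supremum of
    their left ends. *)
Lemma dyadic_limit x : x 0%N = 1 ->
  (forall s, `|x s.+1 - x s| <= 2^-1 ^+ (s + 3) * x s) ->
  exists L : R, [/\ 2^-1 <= L, L <= 2 & forall s, `|L - x s| <= 2^-1 ^+ s.+1].
Proof.
move=> x0 H; have bnd := dyadic_bounds x0 H.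
have p0 s : 0 < (2^-1 : R) ^+ s by rewrite exprn_gt0.
have step s : `|x s.+1 - x s| <= 2^-1 ^+ s.+2.
  apply: le_trans (H s) _; have /andP[_ h] := bnd s; have := p0 s.
  rewrite addnC !exprS; set p := 2^-1 ^+ s in h * => pp.
  have : p * x s <= p * 2 by apply: ler_wpM2l; lra.
  lra.
pose y s := x s - 2^-1 ^+ s.+1; pose u s := x s + 2^-1 ^+ s.+1.
have ym s r : y s <= y (s + r)%N.
  elim: r => [|r IHr]; first by rewrite addn0.
  apply: le_trans IHr _; rewrite addnS /y; have := step (s + r)%N.
  rewrite ler_norml => /andP[h1 _]; move: h1; rewrite !exprS; lra.
have um s r : u (s + r)%N <= u s.
  elim: r => [|r IHr]; first by rewrite addn0.
  apply: le_trans IHr; rewrite addnS /u; have := step (s + r)%N.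
  rewrite ler_norml => /andP[_ h1]; move: h1; rewrite !exprS; lra.
have yu s r : y s <= u r.
  apply: le_trans (ym s r) _; apply: (@le_trans _ _ (u (s + r)%N)).
    by rewrite /y /u; have := p0 (s + r).+1; lra.
  by rewrite addnC; exact: um.
pose A := [set y s | s in [set: nat]].
have Aub r : ubound A (u r) by move=> _ [s _ <-]; exact: yu.
have A0 : A !=set0 by exists (y 0%N), 0%N.
have hs : has_sup A by split => //; exists (u 0%N).
have Ly s : y s <= sup A by apply: sup_upper_bound => //; exists s.
have Lu r : sup A <= u r by apply: ge_sup.
exists (sup A); split.
- apply: le_trans (Ly 0%N); rewrite /y x0 expr1; lra.
- apply: le_trans (Lu 1%N) _; rewrite /u; have /andP[_] := bnd 1%N.
  by rewrite !exprS expr0; lra.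
- by move=> s; have := Ly s; have := Lu s; rewrite /y /u ler_norml => h1 h2; lra.
Qed.

Lemma exists_dyadic_le (e : R) m : 0 < e ->
  exists2 s, (m <= s)%N & 2^-1 ^+ s <= e.
Proof.
move=> e0; have : (fun n => (2^-1 : R) ^+ n) @ \oo --> (0 : R).
  by apply: cvg_expr; rewrite ger0_norm; lra.
move=> /cvgrPdist_le/(_ _ e0)[N _ H]; exists (maxn m N); first exact: leq_maxl.
have := H (maxn m N) (leq_maxr _ _) => /=.
by rewrite sub0r normrN ger0_norm // exprn_ge0.
Qed.

End DyadicLimit.

(** The Weierstrass product inequality. *)
Lemma prod_one_sub_ge (R : realType) (a : nat -> R) m :
  (forall j, 0 <= a j <= 1) -> 1 - \sum_(j < m) a j <= \prod_(j < m) (1 - a j) <= 1.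
Proof.
move=> a01; elim: m => [|m /andP[IH1 IH2]]; first by rewrite big_ord0 big_ord0; lra.
rewrite !big_ord_recr /=; have /andP[a0 a1] := a01 m.
have p0 : 0 <= \prod_(j < m) (1 - a j).
  by apply: prodr_ge0 => j _; have := a01 j; lra.
by apply/andP; split; nra.
Qed.

(** * The coefficients, the limit density and the divergence *)

Section Construction.
Variable R : realType.

(** Stage [s] is given the tolerance [2^-1 ^+ (s + 5)]: summable, and small enough for all densities
    to remain in [[1/2, 2]]. *)
Lemma coefficients_exist : exists (al : nat -> R[i]) (S : nat -> nat),
  [/\ S 0%N = 0%N, forall s, (s <= S s)%N, forall n, cnorm (al n) <= 2^-1 &
      forall s, stage_spec (2^-1 ^+ (s + 5)) (S s.+1 - S s) (fun i => al (S s + i)%N)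
        /\ (S s <= S s.+1)%N].
Proof.
have H s : exists nl : nat * (nat -> R[i]), stage_spec (2^-1 ^+ (s + 5)) nl.1 nl.2.
  have d0 : 0 < (2^-1 : R) ^+ (s + 5) by rewrite exprn_gt0.
  by have [n [l P]] := stage_exists d0; exists (n, l).
have [f fP] := choice H.
have n0 s : (0 < (f s).1)%N by case: (fP s).
have [al [S [S0 SS sS alE alE']]] := concat_exists (0 : R[i]) (fun s => (f s).2) n0.
exists al, S; split=> //.
  by move=> n; have [s [i ->]] := alE' n; case: (fP s).
move=> s; split; last by rewrite SS leq_addr.
rewrite SS addKn; case: (fP s) => h1 h2 h3 h4.
have E i : (i < (f s).1)%N -> al (S s + i)%N = (f s).2 i by exact: alE.
split=> //.
- by move=> i; have [s' [i' ->]] := alE' (S s + i)%N; case: (fP s').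
- apply: le_trans h3; rewrite le_eqVlt; apply/orP; left; apply/eqP.
  by apply: eq_bigr => i _; rewrite E.
- move=> x C v hx hC hv hr; apply: h4 hx hC hv _ => i hi.
  by rewrite hr // E.
Qed.

Variables (al : nat -> R[i]) (S : nat -> nat).
Hypothesis S0 : S 0%N = 0%N.
Hypothesis S_ge : forall s, (s <= S s)%N.
Hypothesis al_le : forall n, cnorm (al n) <= 2^-1.
Hypothesis alP : forall s, stage_spec (2^-1 ^+ (s + 5)) (S s.+1 - S s)
  (fun i => al (S s + i)%N) /\ (S s <= S s.+1)%N.

Let P := szprod al.
Let d (s : nat) : R := 2^-1 ^+ (s + 5).

Let d_bounds s : 0 < d s <= 32^-1.
Proof.
rewrite /d exprn_gt0 //= exprD (_ : 2^-1 ^+ 5 = 32^-1); last by lra.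
have : (2^-1 : R) ^+ s <= 1 by rewrite exprn_ile1 //; lra.
lra.
Qed.

Lemma stage_szprod s i : (S s <= i <= S s.+1)%N ->
  (1 - d s) * P (S s) <= P i <= P (S s).
Proof.
move=> /andP[i1 i2]; have [[_ _ sm _] _] := alP s.
have Pi : P i = P (S s) * \prod_(j < i - S s) (1 - cnorm (al (S s + j)%N) ^+ 2).
  have PD m k : P (m + k)%N = P m * \prod_(j < k) (1 - cnorm (al (m + j)%N) ^+ 2).
    by rewrite /P /szprod big_split_ord.
  by rewrite -PD subnKC.
have P0 : 0 < P (S s) := szprod_gt0 al_le _.
have a01 j : 0 <= cnorm (al (S s + j)%N) ^+ 2 <= 1.
  rewrite sqr_ge0 /= expr_le1 ?cnorm_ge0 //; have := al_le (S s + j)%N; lra.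
have /andP[h1 h2] := prod_one_sub_ge (i - S s) a01.
have h3 : \sum_(j < i - S s) cnorm (al (S s + j)%N) ^+ 2 <= d s.
  apply: le_trans sm; have i3 : (i - S s <= S s.+1 - S s)%N by rewrite leq_sub2r.
  rewrite -(subnKC i3) big_split_ord /= lerDl.
  by apply: sumr_ge0 => j _; exact: sqr_ge0.
by rewrite Pi; apply/andP; split; [rewrite mulrC|]; nra.
Qed.

Let v (x : R) n := (Psi al n).[eT x].

(** The stage is applied to the orbit from index [S s] on, with [C] the power of [eT y] accumulated
    up to there. *)
Lemma stage_orbit x s :
  [/\ (1 - d s) * cnorm (v x (S s)) <= cnorm (v x (S s.+1)),
      cnorm (v x (S s.+1)) <= (1 + d s) * cnorm (v x (S s)) &
      exists i1 i2, [/\ (S s <= i1 <= S s.+1)%N, (S s <= i2 <= S s.+1)%N &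
        cnorm (v x (S s)) / 10 <= cnorm (v x i2 - v x i1)]].
Proof.
have [y y01 xy] := eT_surj (cnorm_eT x).
have [[_ _ _ H] SS] := alP s.
have := H y (eT y ^+ S s) (fun i => v x (S s + i)%N) y01.
rewrite cnormX cnorm_eT expr1n addn0 subnKC // => /(_ erefl).
move=> /(_ (Psi_neq0 al_le _ (cnorm_eT x)))[|h1 h2 [i1 [i2 [j1 j2 h3]]]].
  move=> i _; rewrite addnS /v (Psi_circleS _ _ (cnorm_eT x)) xy.
  by rewrite -exprD addnS.
split=> //; exists (S s + i1)%N, (S s + i2)%N; split=> //.
  by rewrite leq_addr -leq_subRL.
by rewrite leq_addr -leq_subRL.
Qed.

(** The numerator changes by a factor between [1 - d s] and 1, and the modulus in the denominator by
    one between [1 - d s] and [1 + d s]. As [d s <= 1/32], the relative change of the quotient is at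
    most [4 * d s]. *)
Lemma stage_weight x s :
  `|bsweight al (S s.+1) x - bsweight al (S s) x| <=
  2^-1 ^+ (s + 3) * bsweight al (S s) x.
Proof.
have [h1 h2 _] := stage_orbit x s; rewrite /v in h1 h2.
have [_ SS] := alP s.
have /andP[p1 p2] : (1 - d s) * P (S s) <= P (S s.+1) <= P (S s).
  by apply: stage_szprod; rewrite SS leqnn.
have P0 : 0 < P (S s) := szprod_gt0 al_le _.
have v0 : 0 < cnorm (Psi al (S s)).[eT x].
  by rewrite cnorm_gt0 (Psi_neq0 al_le) // cnorm_eT.
have v1 : 0 < cnorm (Psi al (S s.+1)).[eT x].
  by rewrite cnorm_gt0 (Psi_neq0 al_le) // cnorm_eT.
have -> : (2^-1 : R) ^+ (s + 3) = 4 * d s.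
  by rewrite /d !exprD; lra.
rewrite /bsweight -/P.
move: h1 h2 p1 p2 P0 v0 v1 (d_bounds s).
set a := cnorm _; set b := cnorm _; set p := P _; set q := P _; set e := d s.
move=> h1 h2 p1 p2 p0 a0 b0 /andP[e0 e1].
have b2 : 0 < b ^+ 2 by rewrite exprn_gt0.
have a2 : 0 < a ^+ 2 by rewrite exprn_gt0.
pose r := b ^+ 2 / a ^+ 2.
have r1 : (1 - e) ^+ 2 <= r.
  have ea : 0 <= (1 - e) * a by apply: mulr_ge0; [lra|exact: ltW].
  by rewrite /r ler_pdivlMr // -exprMn; apply: lerXn2r h1; rewrite nnegrE // ltW.
have r2 : r <= (1 + e) ^+ 2.
  have ea : 0 <= (1 + e) * a by apply: mulr_ge0; [lra|exact: ltW].
  by rewrite /r ler_pdivrMr // -exprMn; apply: lerXn2r h2; rewrite nnegrE // ltW.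
have W0 : 0 < p / a ^+ 2 by rewrite divr_gt0.
have W1 : 0 <= q / b ^+ 2.
  by rewrite divr_ge0 ?ltW //; apply: lt_le_trans p1; rewrite mulr_gt0 //; lra.
have E : q / b ^+ 2 * r = q / a ^+ 2 by rewrite /r; field; rewrite !gt_eqF.
have Q1 : (1 - e) * (p / a ^+ 2) <= q / a ^+ 2 by rewrite mulrA ler_pM2r ?invr_gt0.
have Q2 : q / a ^+ 2 <= p / a ^+ 2 by rewrite ler_pM2r ?invr_gt0.
move: W0 W1 E Q1 Q2; set W := p / _; set V := q / b ^+ 2; set Q := q / a ^+ 2.
move=> W0 W1 E Q1 Q2.
have f1 : 1 <= (1 + 4 * e) * (1 - e) ^+ 2 by nra.
have f2 : (1 - 4 * e) * (1 + e) ^+ 2 <= 1 - e by nra.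
have g1 : V * (1 - e) ^+ 2 <= W.
  by apply: le_trans Q2; rewrite -E ler_wpM2l.
have g2 : (1 - e) * W <= V * (1 + e) ^+ 2.
  by apply: le_trans Q1 _; rewrite -E ler_wpM2l.
have k1 : V <= (1 + 4 * e) * W.
  have := ler_wpM2l W1 f1; rewrite mulr1 => /le_trans; apply.
  by rewrite mulrCA ler_wpM2l //; lra.
have k2 : (1 - 4 * e) * W <= V.
  have e1' : 0 < 1 - e by lra.
  rewrite -(ler_pM2l e1') mulrCA.
  apply: (@le_trans _ _ ((1 - 4 * e) * (V * (1 + e) ^+ 2))).
    by rewrite ler_wpM2l //; lra.
  by rewrite mulrCA [(1 - e) * V]mulrC ler_wpM2l.
by rewrite ler_norml; apply/andP; split; lra.
Qed.

Lemma bsweight_stage_bounds x s : 2^-1 <= bsweight al (S s) x <= 2.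
Proof.
have w0 : bsweight al (S 0%N) x = 1.
  by rewrite S0 /bsweight /szprod big_ord0 /Psi /= hornerC cnorm1 expr1n divr1.
have /andP[h1 h2] := dyadic_bounds (x := fun s => bsweight al (S s) x) w0
  (stage_weight x) s.
have : 0 < (2^-1 : R) ^+ s.+1 by rewrite exprn_gt0.
have : 0 < (2^-1 : R) ^+ s by rewrite exprn_gt0.
by move=> ? ?; apply/andP; split; lra.
Qed.

Lemma weight_exists : exists w : R -> R,
  [/\ measurable_fun setT w, forall x, 2^-1 <= w x <= 2 &
      forall s x, `|w x - bsweight al (S s) x| <= 2^-1 ^+ s.+1].
Proof.
have H x : exists L : R, [/\ 2^-1 <= L, L <= 2 &
    forall s, `|L - bsweight al (S s) x| <= 2^-1 ^+ s.+1].
  apply: (@dyadic_limit _ (fun s => bsweight al (S s) x)); last exact: stage_weight.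
  by rewrite S0 /bsweight /szprod big_ord0 /Psi /= hornerC cnorm1 expr1n divr1.
have [w wP] := choice H; exists w; split; last first.
- by move=> s x; case: (wP x).
- by move=> x; case: (wP x) => -> ->.
apply: (@measurable_fun_cvg _ _ _ setT (fun s x => bsweight al (S s) x)).
  by move=> s; case: (bm_bsweight al_le (S s)).
move=> x _; apply/cvgrPdist_le => e e0; have [s0 _ hs0] := exists_dyadic_le 0 e0.
exists s0 => // s /= s0s; case: (wP x) => _ _ /(_ s) /le_trans; apply.
apply: le_trans hs0; apply: ler_wiXn2l; [lra|lra|exact: leqW].
Qed.

(** In a late stage a convergent sequence stays within 1/100 of its limit [l], and the normalization
    varies by a relative amount so small that [v] moves by at most [p / 25]. But the stage forces a
    motion of [cnorm (v x (S s)) / 10], at least [p / 20] because the density is at most 2. *)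
Lemma star_diverges x :
  ~ cseq_converges (fun n => ((Num.sqrt (P n))^-1)%:C * v x n).
Proof.
pose u n := ((Num.sqrt (P n))^-1)%:C * v x n.
move=> [l ul]; have e100 : 0 < 100^-1 :> R by lra.
have [N uN] : exists N, forall n, (N <= n)%N -> cnorm (u n - l) < 100^-1.
  exact: ul e100.
have l0 := cnorm_ge0 l.
have e0 : 0 < (100 * (cnorm l + 1))^-1 by rewrite invr_gt0; lra.
have [s Ns hs] := exists_dyadic_le N e0.
have /andP[d0 d1] := d_bounds s.
have ds : d s * (cnorm l + 1) <= 100^-1.
  have : d s <= (100 * (cnorm l + 1))^-1.
    by apply: le_trans hs; rewrite /d; apply: ler_wiXn2l; [lra|lra|exact: leq_addr].
  rewrite -(ler_pM2r (_ : 0 < cnorm l + 1)); last by lra.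
  by move=> /le_trans; apply; rewrite invfM mulfVK // gt_eqF //; lra.
have P0 n : 0 < P n := szprod_gt0 al_le n.
have sqP n : 0 < Num.sqrt (P n) by rewrite sqrtr_gt0.
have vu n : v x n = (Num.sqrt (P n))%:C * u n.
  by rewrite /u mulrA -rmorphM /= divff ?mul1r // gt_eqF.
pose p := Num.sqrt (P (S s)).
have p0 : 0 < p by exact: sqP.
have p2 : p ^+ 2 = P (S s) by rewrite sqr_sqrtr // ltW.
have vS : p / 2 <= cnorm (v x (S s)).
  have /andP[_ X2] := bsweight_stage_bounds x s.
  have v0 : 0 < cnorm (v x (S s)).
    by rewrite cnorm_gt0 (Psi_neq0 al_le) // cnorm_eT.
  rewrite /bsweight -/(v x (S s)) -/P -p2 ler_pdivrMr ?exprn_gt0 // in X2.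
  have ph : 0 <= p / 2 by lra.
  by rewrite -ler_sqr ?nnegrE ?ph ?(ltW v0) //; nra.
have [_ _ [i1 [i2 [/[dup] j1 /andP[k1 _] /[dup] j2 /andP[k2 _] mv]]]] := stage_orbit x s.
have ub i : (S s <= i)%N -> cnorm (u i - l) <= 100^-1.
  by move=> si; apply: ltW; apply: uN; exact: leq_trans (leq_trans Ns (S_ge s)) si.
have uB i : (S s <= i)%N -> cnorm (u i) <= cnorm l + 1.
  move=> si; have := ub i si; have := cnormD (u i - l) l; rewrite subrK; lra.
have bB i : (S s <= i <= S s.+1)%N -> 0 <= p - Num.sqrt (P i) <= d s * p.
  move=> si; have /andP[q1 q2] := stage_szprod si.
  have bi := sqP i; have b2 : Num.sqrt (P i) ^+ 2 = P i by rewrite sqr_sqrtr // ltW.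
  rewrite -p2 -b2 in q1 q2; set b := Num.sqrt (P i) in bi b2 q1 q2 *.
  have h1 : b <= p by rewrite -ler_sqr // nnegrE ltW.
  have h2 : (1 - d s) * p <= b.
    have e1 : 0 <= 1 - d s by lra.
    rewrite -ler_sqr ?nnegrE ?(ltW bi) ?(mulr_ge0 e1 (ltW p0)) //.
    by apply: le_trans q1; rewrite exprMn ler_wpM2r ?sqr_ge0 //; nra.
  by apply/andP; split; lra.
have E : v x i2 - v x i1 = p%:C * (u i2 - u i1)
    - (p - Num.sqrt (P i2))%:C * u i2 + (p - Num.sqrt (P i1))%:C * u i1.
  by rewrite !vu !rmorphB /=; ring.
have n1 : cnorm (p%:C * (u i2 - u i1)) <= p * (50^-1).
  rewrite cnormM cnormR ger0_norm ?(ltW p0) // ler_wpM2l ?(ltW p0) //.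
  have := cnorm_triangle (u i2) l (u i1); rewrite [cnorm (l - _)]cnormBC.
  by have := ub _ k1; have := ub _ k2; lra.
have n2 i : (S s <= i <= S s.+1)%N ->
    cnorm ((p - Num.sqrt (P i))%:C * u i) <= p * (100^-1).
  move=> si; have /andP[c1 c2] := bB i si; have /andP[si' _] := si.
  rewrite cnormM cnormR ger0_norm //.
  apply: le_trans (ler_pM c1 (cnorm_ge0 _) c2 (uB i si')) _.
  by rewrite mulrAC mulrC ler_wpM2l // (ltW p0).
have := n2 _ j1; have := n2 _ j2; move: mv n1; rewrite E.
set a1 := p%:C * _; set a2 := _%:C * u i2; set a3 := _%:C * u i1.
have := cnormD (a1 - a2) a3; have := cnormB a1 a2; lra.
Qed.

End Construction.

(** * Infinite support and the Szego condition *)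

Section Support.
Variables (R : realType) (w : R -> R) (sigma : {measure set R -> \bar R}).
Notation mu := (@lebesgue_measure R).
Hypothesis mw : measurable_fun setT w.
Hypothesis w_ge : forall x, 2^-1 <= w x.
Hypothesis sigmaE : forall A : set R, measurable A -> A `<=` @I01 R ->
  sigma A = (\int[mu]_(x in A) (w x)%:E)%E.

Lemma density_itv_gt0 (a b : R) : 0 <= a -> a < b -> b < 1 -> (0 < sigma `]a, b[%classic)%E.
Proof.
move=> a0 ab b1; rewrite sigmaE; last 2 first.
- exact: measurable_itv.
- by move=> x /=; rewrite /I01 /= !in_itv /= => /andP[h1 h2]; apply/andP; split; lra.
apply: (@lt_le_trans _ _ (\int[mu]_(x in `]a, b[%classic) (2^-1)%:E)%E).
  rewrite integral_cst //= lebesgue_measure_itv /= lte_fin ab -EFinB -EFinM lte_fin.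
  by rewrite mulr_gt0 ?subr_gt0.
apply: ge0_le_integral => //=.
- by apply/measurable_EFinP; exact: measurable_funTS.
- by move=> x _; rewrite lee_fin.
Qed.

Lemma arc_measurable (z : R[i]) (e : R) :
  measurable (@I01 R `&` [set x | (cnorm (eT x - z) < e)%R]).
Proof.
apply: measurableI; first exact: measurable_itv.
have [e0|e0] := leP e 0.
  rewrite (_ : [set x | _] = set0) //; apply/seteqP; split=> // x /= h.
  by have := cnorm_ge0 (eT x - z); lra.
have [m1 m2 _] : bounded_measurable (fun x : R => eT x - z).
  by apply: bmD; [exact: bm_eT|exact: bm_cst].
have mh : measurable_fun setT (fun x : R => cnorm (eT x - z) ^+ 2).
  under eq_fun do rewrite cnorm_sqr.
  by apply: measurable_funD; exact: measurable_funX.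
have := mh measurableT `]-oo, e ^+ 2[%classic (measurable_itv _).
rewrite setTI; congr measurable; apply/seteqP; split=> x /=; rewrite in_itv /=.
  by move=> h; rewrite -ltr_sqr ?nnegrE ?cnorm_ge0 ?(ltW e0).
by move=> h; rewrite ltr_sqr ?nnegrE ?cnorm_ge0 ?(ltW e0).
Qed.

(** The arc of angles between [t] and [t + h] has positive mass. With [h <= 1/8] it stays inside
    [[0, 1)], and with [h <= e / 16] it stays within [e] of [eT t]. *)
Lemma eT_in_supp t : 0 <= t <= 2^-1 -> supp sigma (eT t).
Proof.
move=> /andP[t0 t2]; split; first exact: cnorm_eT.
move=> e e0; pose h := Num.min (8^-1) (e / 16).
have h0 : 0 < h by rewrite lt_min; apply/andP; split; lra.
have h8 : h <= 8^-1 by rewrite ge_min lexx.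
have h16 : h <= e / 16 by rewrite ge_min lexx orbT.
apply: (@lt_le_trans _ _ (sigma `]t, t + h[%classic)).
  by apply: density_itv_gt0; lra.
apply: le_measure; rewrite ?inE.
- exact: measurable_itv.
- exact: arc_measurable.
move=> x /=; rewrite in_itv /= => /andP[x1 x2]; split.
  by rewrite /I01 /= in_itv /=; apply/andP; split; lra.
have xt : 0 < x - t <= 8^-1 by apply/andP; split; lra.
have [_ _ n _ _] := eT_arc xt.
have D : eT x - eT t = eT t * (eT (x - t) - 1).
  by rewrite mulrBr mulr1 -eTD [t + _]addrC subrK.
change (cnorm (eT x - eT t) < e); rewrite D cnormM cnorm_eT mul1r.
apply: (@le_lt_trans _ _ (8 * (x - t))); last by lra.
rewrite -ler_sqr ?nnegrE ?cnorm_ge0 //; last by lra.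
by apply: le_trans n _; lra.
Qed.

(** The angles [1 / (k + 2)] lie in []0, 1/2]], where the real part of [eT] already separates
    points. *)
Lemma infinite_supp : infinite_support sigma.
Proof.
move=> fs; pose f (k : nat) : R[i] := eT (k.+2%:R^-1).
have k01 (k : nat) : 0 < (k.+2%:R^-1 : R) <= 2^-1.
  by rewrite invr_gt0 ltr0n /= lef_pV2 ?posrE ?ltr0n // ler_nat.
have inj : injective f.
  move=> j k /(congr1 (@complex.Re R)) /= /cos_inj E; apply: succn_inj; apply: succn_inj.
  apply/eqP; rewrite -(eqr_nat R) -(inj_eq invr_inj); apply/eqP.
  have pi0 : 0 < 2 * pi :> R by rewrite mulr_gt0 // pi_gt0.
  have itv (y : R) : 0 < y <= 2^-1 -> 0 <= 2 * pi * y <= pi.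
    move=> /andP[y0 y2]; have p0 := @pi_gt0 R.
    have := mulr_gt0 p0 y0; have := ler_wpM2l (ltW p0) y2.
    by move=> *; apply/andP; split; lra.
  by apply: (mulfI (lt0r_neq0 pi0)); apply: E; rewrite in_itv /= itv.
have := finite_preimage (fun x y _ _ => @inj x y) fs.
rewrite (_ : f @^-1` _ = setT); first exact: infinite_nat.
apply/seteqP; split=> // k _; apply: eT_in_supp.
by have /andP[h1 h2] := k01 k; rewrite (ltW h1) h2.
Qed.

(** The singular part is zero, and the lower bound 1/2 on [w] bounds the logarithmic integral from
    below. *)
Lemma szego_class_density (w2 : forall x, w x <= 2) : szego_class sigma.
Proof.
have w0 x : 0 <= w x by have := w_ge x; lra.
exists w, (mzero : {measure set R -> \bar R}); split=> //.
- exact: measurable_funTS.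
- exists set0; split=> //; exact: measure0.
- by move=> A mA AI; rewrite sigmaE // adde0.
have mI := @measurable_I01 R.
have lnb x : ln (2^-1) <= ln (w x) :> R.
  by rewrite ler_ln ?posrE //; apply: lt_le_trans (w_ge x).
have -> : (\int[mu]_(x in @I01 R) lne (w x)%:E =
    \int[mu]_(x in @I01 R) (ln (w x))%:E)%E.
  by apply: eq_integral => x _; rewrite lne_EFin //; apply: lt_le_trans (w_ge x).
apply: (@lt_le_trans _ _ (\int[mu]_(x in @I01 R) (ln 2^-1)%:E)%E).
  by rewrite integral_cst //= lebesgue_I01 mule1 ltNyr.
have mln : measurable_fun setT (fun x => ln (w x)).
  by apply: measurableT_comp => //; exact: measurable_ln.
apply: le_integral => //.
- by apply: (bounded_integrable (M := `|ln (2^-1 : R)|)).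
- apply: (bounded_integrable (M := `|ln (2^-1 : R)| + `|ln (2 : R)|)) => // x.
  have : ln (w x) <= ln 2 by rewrite ler_ln ?posrE //; apply: lt_le_trans (w_ge x).
  have := lnb x; rewrite ler_norml.
  have := ler_norm (ln (2 : R)); have := ler_norm (- ln (2^-1 : R)); rewrite normrN.
  have := normr_ge0 (ln (2 : R)); have := normr_ge0 (ln (2^-1 : R)).
  by move=> *; apply/andP; split; lra.
- by move=> x _; rewrite lee_fin.
Qed.

End Support.

(** * The measure [w dm] and its properties *)

Theorem theorem1p2 (R : realType) :
  exists sigma : {measure set R -> \bar R},
    [/\ prob_on_T sigma,
        infinite_support sigma,
        szego_class sigma,
        (exists phi : nat -> {poly R[i]}, is_OPUC sigma phi)
      & forall phi : nat -> {poly R[i]}, is_OPUC sigma phi ->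
          forall z : R[i], cnorm z = 1 ->
            ~ cseq_converges (fun n => Qstar n (phi n) z)].
Proof.
have [al [S [S0 S_ge al_le alP]]] := coefficients_exist R.
have [w [mw w12 wS]] := weight_exists S0 al_le alP.
have w1 x : 2^-1 <= w x by have /andP[] := w12 x.
have w2 x : w x <= 2 by have /andP[] := w12 x.
have w0 x : 0 <= w x by have := w1 x; lra.
have bw : bounded_measurable (fun x => (w x)%:C).
  by apply: (bm_real (M := 2)) => // x; rewrite ger0_norm.
have w_lim n (e : R) : 0 < e ->
    exists2 M, (n <= M)%N & forall x, `|w x - bsweight al M x| <= e.
  move=> e0; have [s ns se] := exists_dyadic_le n e0.
  exists (S s) => [|x]; first exact: leq_trans ns (S_ge s).
  apply: le_trans (wS s x) _; apply: le_trans se.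
  by apply: ler_wiXn2l => //; lra.
have [sigma [sigmaE sigmaC sigma_int]] := density_exists mw w0 w2.
have cintE p q : cint sigma (fun x => p.[eT x] * conjc q.[eT x]) = inner w p q.
  rewrite sigma_int //.
  by apply: bmM; [|apply: bmJ]; exact: bm_horner.
have mI := @measurable_I01 R.
have sigma1 : sigma (@I01 R) = 1%E.
  rewrite sigmaE //.
  have : mean (fun x => (w x)%:C) = 1.
    (* The total mass is the squared norm of the constant polynomial [phin al 0 = 1]. *)
    transitivity (inner w (phin al 0) (phin al 0)); last first.
      by rewrite (inner_phin al_le bw w_lim) eqxx.
    apply: eq_mean => x; rewrite /phin /szprod big_ord0 sqrtr1 invr1 scale1r.
    by rewrite /Phi /= hornerC conjc1 !mul1r.
  move=> /(congr1 (@complex.Re R)) /=; rewrite /Rintegral => <-.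
  rewrite fineK //; apply: integrable_fin_num => //.
  by apply: (bounded_integrable (M := 2)) => // x; rewrite ger0_norm.
exists sigma; split.
- by split.
- exact: infinite_supp mw w1 sigmaE.
- exact: szego_class_density mw w1 sigmaE w2.
- exists (phin al); split; first exact: phin_size.
  by move=> n k; rewrite cintE; exact: inner_phin.
move=> phi [phi_sz phi_on] z z1.
(* Uniqueness reduces an arbitrary orthonormal sequence to the constructed one. *)
have phiE : phi =1 phin al.
  apply: (orthonormal_unique al_le bw w_lim); split=> // n k.
  by rewrite -cintE.
have [x _ zx] := eT_surj z1.
(* On the circle [(conjc z)^-1 = z], so the reversed polynomial is the normalized [Psi al n], to
   which the divergence applies. *)
have E n : Qstar n (phi n) z =
    ((Num.sqrt (szprod al n))^-1)%:C * (Psi al n).[eT x].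
  rewrite /Qstar phiE (_ : (conjc z)^-1 = z); last by rewrite invc_circle ?conjcK // cnormJ.
  rewrite /phin hornerZ conjcM conjc_real (Phi_circle _ _ z1) conjcM conjcK -zx.
  by rewrite -[RHS]mulr1 -(unitJ n z1); ring.
rewrite (_ : (fun n => _) = fun n => ((Num.sqrt (szprod al n))^-1)%:C *
  (Psi al n).[eT x]); last by apply/funext.
exact: (star_diverges S0 S_ge al_le alP).
Qed.
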